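(* For every pair of integers $r \geq -1$, $M \geq 0$, we have $$\mathbf{Poly}_{2}(r,M) = \big\{ V \text{ an } \mathbf{FI}\text{-module} : \delta(V) \leq r \text{ and } \operatorname{reg}(V) \leq M-1 \big\}.$$
   Context: $\mathbf{FI}$ is the category of finite sets and injections. An $\mathbf{FI}$-module is a functor $V$ from $\mathbf{FI}$ to the category of $\mathbb{Z}$-modules; $V_S$ is its value at a finite set $S$ and $V_\alpha : V_S \to V_T$ the map induced by an injection $\alpha : S \hookrightarrow T$. $\mathbf{FI}$-modules form an abelian category with kernels and cokernels computed pointwise. Degree: $\deg(W) := \min\{d \geq -1 : W_S = 0 \text{ for all finite } S \text{ with } |S| > d\} \in \{-1,0,1,\dots\}\cup\{\infty\}$ (with $\deg(W)=\infty$ if no such $d$ exists). Torsion: $V$ is torsion if for every finite set $S$ and $x \in V_S$ there is an injection $\alpha : S \hookrightarrow T$ of finite sets with $V_\alpha(x) = 0$. $\mathrm{H}^0_{\mathfrak m}(V)$ is the largest torsion $\mathbf{FI}$-submodule of $V$, and $h^0(V) := \deg(\mathrm{H}^0_{\mathfrak m}(V))$. Shift and derivative: $\mathbf{\Sigma} V$ is the composition of $-\sqcup\{*\} : \mathbf{FI} \to \mathbf{FI}$ with $V$; the inclusions $S \hookrightarrow S\sqcup\{*\}$ give a natural map $V \to \mathbf{\Sigma} V$, and $\mathbf{\Delta} V := \operatorname{coker}(V \to \mathbf{\Sigma} V)$. Stable degree: $\delta(V) := \min\{r \geq -1 : \mathbf{\Delta}^{r+1}(V) \text{ is torsion}\}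 \in \{-1,0,1,\dots\}\cup\{\infty\}$. $\mathbf{FI}$-homology and regularity: $\mathrm{H}_0^{\mathbf{FI}}$ is the right exact functor on $\mathbf{FI}$-modules given by $\mathrm{H}_0^{\mathbf{FI}}(V)_S := \operatorname{coker}\big(\bigoplus_{T \subsetneq S} V_T \to V_S\big)$ (maps induced by the inclusions $T \subsetneq S$), and $\mathrm{H}_i^{\mathbf{FI}}$ ($i \ge 0$) is its $i$-th left derived functor. Set $t_i(V) := \deg(\mathrm{H}_i^{\mathbf{FI}}(V))$ and $\operatorname{reg}(V) := \max\{t_i(V) - i : i \geq 1\} \in \{-2,-1,0,1,\dots\}\cup\{\infty\}$ ($\infty$ if unbounded). The class $\mathbf{Poly}_2(r,M)$ is defined recursively for integers $r\ge -1$, $M\ge 0$: $\mathbf{Poly}_2(-1,M)$ is the class of $\mathbf{FI}$-modules $V$ with $\deg(V)\le M-1$; for $r \geq 0$, $\mathbf{Poly}_2(r,M)$ is the class of $\mathbf{FI}$-modules $V$ such that $h^0(V) \leq M-1$ and $\mathbf{\Delta} V \in \mathbf{Poly}_2(r-1,\max\{0,M-1\})$. *)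

(* Defs.v *)
From HB Require Import structures.
From mathcomp Require Import all_boot all_order all_algebra.
From mathcomp Require Import boolp classical_sets constructive_ereal.
From mathcomp Require Import freeg.

Set Implicit Arguments.
Unset Strict Implicit.
Unset Printing Implicit Defensive.

Import Order.TTheory GRing.Theory Num.Theory.

Local Open Scope ring_scope.
Local Open Scope classical_set_scope.

Definition mk_additive (U V : zmodType) (f : U -> V) (fB : zmod_morphism f) :
  {additive U -> V} := HB.pack f (GRing.isZmodMorphism.Build U V f fB).

Definition asbool_pred (G : Type) (P : G -> Prop) : pred G := fun x => `[< P x >].

Definition mk_subgroup (G : zmodType) (P : G -> Prop) (P0 : P 0)
    (PB : forall x y, P x -> P y -> P (x - y)) : zmodClosed G :=
  HB.pack (asbool_pred P)
    (GRing.isZmodClosed.Build G (asbool_pred P)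
      (conj (asboolT P0)
        (fun x y Px Py => asboolT (PB x y (asboolW Px) (asboolW Py))))).

Lemma mem_mk_subgroup (G : zmodType) (P : G -> Prop) P0 PB x :
  (x \in @mk_subgroup G P P0 PB) <-> P x.
Proof. by split=> [/asboolW|/asboolT]. Qed.

Section SubZmod.
Variables (G : zmodType) (I : zmodClosed G).
Definition sub_zmod := {x : G | x \in I}.
HB.instance Definition _ := SubChoice.on sub_zmod.
HB.instance Definition _ := [SubChoice_isSubZmodule of sub_zmod by <:].
End SubZmod.

Section FreeZmod.
Variables (K : choiceType) (M : zmodType).

Definition freeZ : zmodType := {freeg K / int}.
Definition freeZ_gen (k : K) : freeZ := << k >>.

(* [M] is made a module over [int] through the alias [zmodule M]. *)
Definition freeZ_lift_fun (h : K -> M) (x : freeZ) : M := fglift (h : K -> zmodule M) x.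

Lemma freeZ_lift_subproof h : zmod_morphism (freeZ_lift_fun h).
Proof. exact: (@lift_is_additive _ K (zmodule M) h). Qed.

Definition freeZ_lift h : {additive freeZ -> M} := mk_additive (freeZ_lift_subproof h).

Lemma freeZ_lift_gen h k : freeZ_lift h (freeZ_gen k) = h k.
Proof. by rewrite /= /freeZ_lift_fun liftU scale1r. Qed.

Lemma freeZ_ext (f g : {additive freeZ -> M}) :
  (forall k, f (freeZ_gen k) = g (freeZ_gen k)) -> f =1 g.
Proof.
move=> fg x; rewrite -(freeg_sumE (x : {freeg K / int})) !raddf_sum.
apply: eq_bigr => k _.
have -> : << coeff k x *g k >> = freeZ_gen k *~ coeff k x :> freeZ.
  by rewrite /freeZ_gen freegU_mulz intz.
by rewrite !raddfMz fg.
Qed.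

End FreeZmod.
Arguments freeZ_lift : simpl never.

Record FIinj (S T : finType) := FIInj {
  FIinj_fun :> {ffun S -> T};
  FIinj_subproof : injectiveb FIinj_fun }.

HB.instance Definition _ (S T : finType) := [isSub for @FIinj_fun S T].
HB.instance Definition _ (S T : finType) := [Finite of FIinj S T by <:].

Lemma FIinj_inj (S T : finType) (f : FIinj S T) : injective f.
Proof. exact/injectiveP/FIinj_subproof. Qed.

Lemma FIinjP (S T : finType) (f g : FIinj S T) : f =1 g -> f = g.
Proof. by move=> fg; apply/val_inj/ffunP. Qed.

Definition mk_inj (S T : finType) (f : S -> T) (fI : injective f) : FIinj S T :=
  @FIInj S T [ffun x => f x]
    (introT (injectiveP [ffun x => f x]) (eq_inj fI (fsym (ffunE f)))).

Lemma mk_injE (S T : finType) (f : S -> T) (fI : injective f) x : mk_inj fI x = f x.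
Proof. by rewrite ffunE. Qed.

Definition FIid (S : finType) : FIinj S S := mk_inj (f := id) (fun x y e => e).
Definition FIcomp (S T U : finType) (g : FIinj T U) (f : FIinj S T) : FIinj S U :=
  mk_inj (inj_comp (@FIinj_inj _ _ g) (@FIinj_inj _ _ f)).

Definition FIincl (S : finType) (A : {set S}) : FIinj {x : S | x \in A} S := mk_inj val_inj.

(* [S ⊔ {*}] is [option S]. *)
Definition FIsome (S : finType) : FIinj S (option S) := mk_inj (f := Some) (fun x y e => Some_inj e).
Definition FIoption (S T : finType) (f : FIinj S T) : FIinj (option S) (option T) :=
  mk_inj (inj_omap (@FIinj_inj _ _ f)).

Lemma FIidE (S : finType) s : FIid S s = s.
Proof. exact: mk_injE. Qed.
Lemma FIcompE (S T U : finType) (g : FIinj T U) (f : FIinj S T) s :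
  FIcomp g f s = g (f s).
Proof. exact: mk_injE. Qed.
Lemma FIinclE (S : finType) (A : {set S}) s : FIincl A s = val s.
Proof. exact: mk_injE. Qed.
Lemma FIsomeE (S : finType) s : FIsome S s = Some s.
Proof. exact: mk_injE. Qed.
Lemma FIoptionE (S T : finType) (f : FIinj S T) s : FIoption f s = omap f s.
Proof. exact: mk_injE. Qed.

Definition FIE := (FIidE, FIcompE, FIinclE, FIsomeE, FIoptionE).

Record FImod := FIMod {
  FIobj :> finType -> zmodType;
  FImap : forall S T : finType, FIinj S T -> {additive FIobj S -> FIobj T};
  FImap_id : forall (S : finType) x, FImap (FIid S) x = x;
  FImap_comp : forall (S T U : finType) (g : FIinj T U) (f : FIinj S T) x,
    FImap (FIcomp g f) x = FImap g (FImap f x) }.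

Record FIhom (V W : FImod) := FIHom {
  FIhom_fun :> forall S : finType, {additive V S -> W S};
  FIhom_nat : forall (S T : finType) (f : FIinj S T) x,
    FIhom_fun T (FImap V f x) = FImap W f (FIhom_fun S x) }.

Record FIsub (V : FImod) := FISub {
  FIsub_mem :> forall S : finType, zmodClosed (V S);
  FIsub_stable : forall (S T : finType) (f : FIinj S T) x,
    x \in FIsub_mem S -> FImap V f x \in FIsub_mem T }.

Definition mk_FIsub (V : FImod) (P : forall S : finType, V S -> Prop)
    (P0 : forall S, P S 0) (PB : forall S x y, P S x -> P S y -> P S (x - y))
    (Pmap : forall S T f x, P S x -> P T (FImap V f x)) : FIsub V :=
  @FISub V (fun S => mk_subgroup (P0 S) (PB S))
    (fun S T f x Px => asboolT (Pmap S T f x (asboolW Px))).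

Lemma mem_mk_FIsub (V : FImod) (P : forall S : finType, V S -> Prop) P0 PB Pmap
    (S : finType) x :
  (x \in @mk_FIsub V P P0 PB Pmap S) <-> P S x.
Proof. exact: mem_mk_subgroup. Qed.

Section SubFImod.
Variables (V : FImod) (N : FIsub V).

Definition sub_obj (S : finType) : zmodType := sub_zmod (N S).

Section Map.
Variables (S T : finType) (f : FIinj S T).
Definition sub_map_fun (x : sub_obj S) : sub_obj T :=
  exist _ (FImap V f (val x)) (FIsub_stable f (valP x)).
Lemma sub_map_subproof : zmod_morphism sub_map_fun.
Proof. by move=> x y; apply: val_inj; rewrite /= !raddfB. Qed.
Definition sub_map := mk_additive sub_map_subproof.
End Map.

Lemma sub_map_id (S : finType) x : sub_map (FIid S) x = x.
Proof. by apply: val_inj; rewrite /= FImap_id. Qed.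

Lemma sub_map_comp (S T U : finType) (g : FIinj T U) (f : FIinj S T) x :
  sub_map (FIcomp g f) x = sub_map g (sub_map f x).
Proof. by apply: val_inj; rewrite /= FImap_comp. Qed.

Definition subFI : FImod := FIMod sub_map_id sub_map_comp.

Definition sub_incl_fun (S : finType) (x : subFI S) : V S := val x.
Lemma sub_incl_subproof S : zmod_morphism (@sub_incl_fun S).
Proof. by move=> x y; rewrite /sub_incl_fun raddfB. Qed.
Definition sub_incl : FIhom subFI V.
Proof. by apply: (@FIHom _ _ (fun S => mk_additive (@sub_incl_subproof S))). Defined.

End SubFImod.

Section QuotFImod.
Variables (V : FImod) (N : FIsub V).

Definition quot_obj (S : finType) : zmodType := Quotient.quot (N S).

Definition quot_pi_fun (S : finType) (x : V S) : quot_obj S :=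
  \pi_(Quotient.quot (N S))%qT x.
Lemma quot_pi_subproof S : zmod_morphism (@quot_pi_fun S).
Proof. by move=> x y; rewrite /quot_pi_fun raddfB. Qed.
Definition quot_pi (S : finType) : {additive V S -> quot_obj S} :=
  mk_additive (@quot_pi_subproof S).

Lemma quot_pi_eq (S : finType) (x y : V S) :
  quot_pi S x = quot_pi S y <-> x - y \in N S.
Proof. by rewrite Quotient.idealrBE; split=> [/eqP|/eqP]. Qed.

Lemma quot_pi_eq0 (S : finType) (x : V S) : quot_pi S x = 0 <-> x \in N S.
Proof. by rewrite -[in X in X <-> _](raddf0 (quot_pi S)) quot_pi_eq subr0. Qed.

Lemma quot_pi_repr (S : finType) (q : quot_obj S) :
  quot_pi S (repr (q : Quotient.quot (N S))) = q.
Proof. exact: reprK. Qed.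

End QuotFImod.

Section QuotLift.
Variables (V : FImod) (N : FIsub V) (S : finType) (G : zmodType).
Variables (f : {additive V S -> G}) (f0 : forall x, x \in N S -> f x = 0).

Definition quot_lift_fun (q : quot_obj N S) : G := f (repr (q : Quotient.quot (N S))).

Lemma quot_lift_pi_fun x : quot_lift_fun (quot_pi N S x) = f x.
Proof.
apply/eqP; rewrite -subr_eq0 -raddfB; apply/eqP/f0.
by apply/quot_pi_eq; rewrite quot_pi_repr.
Qed.

Lemma quot_lift_subproof : zmod_morphism quot_lift_fun.
Proof.
move=> p q; rewrite -[p]quot_pi_repr -[q]quot_pi_repr -raddfB.
by rewrite !quot_lift_pi_fun raddfB.
Qed.

Definition quot_lift : {additive quot_obj N S -> G} := mk_additive quot_lift_subproof.

Lemma quot_lift_pi x : quot_lift (quot_pi N S x) = f x.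
Proof. exact: quot_lift_pi_fun. Qed.

End QuotLift.

Section QuotFImod2.
Variables (V : FImod) (N : FIsub V).

Lemma quot_map_subproof (S T : finType) (f : FIinj S T) x :
  x \in N S -> (quot_pi N T \o FImap V f) x = 0.
Proof. by move=> Nx; apply/quot_pi_eq0/FIsub_stable. Qed.

Definition quot_map (S T : finType) (f : FIinj S T) :
    {additive quot_obj N S -> quot_obj N T} :=
  quot_lift (@quot_map_subproof S T f).

Lemma quot_map_pi (S T : finType) (f : FIinj S T) x :
  quot_map f (quot_pi N S x) = quot_pi N T (FImap V f x).
Proof. exact: quot_lift_pi. Qed.

Lemma quot_map_id (S : finType) x : quot_map (FIid S) x = x.
Proof. by rewrite -[x]quot_pi_repr quot_map_pi FImap_id. Qed.

Lemma quot_map_comp (S T U : finType) (g : FIinj T U) (f : FIinj S T) x :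
  quot_map (FIcomp g f) x = quot_map g (quot_map f x).
Proof. by rewrite -[x]quot_pi_repr !quot_map_pi FImap_comp. Qed.

Definition quotFI : FImod := FIMod quot_map_id quot_map_comp.

Lemma quotFI_map_pi (S T : finType) (f : FIinj S T) x :
  FImap quotFI f (quot_pi N S x) = quot_pi N T (FImap V f x).
Proof. exact: quot_map_pi. Qed.

Definition quot_proj : FIhom V quotFI.
Proof.
by apply: (@FIHom V quotFI (quot_pi N)) => S T f x; rewrite -quot_map_pi.
Defined.

End QuotFImod2.

Section KerIm.
Variables (V W : FImod) (f : FIhom V W).

Definition kerFI : FIsub V.
Proof.
apply: (@mk_FIsub V (fun S x => f S x = 0)) => [S|S x y fx fy|S T g x fx].
- exact: raddf0.
- by rewrite raddfB fx fy subr0.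
- by rewrite FIhom_nat fx raddf0.
Defined.

Definition imFI : FIsub W.
Proof.
apply: (@mk_FIsub W (fun S y => exists x, f S x = y))
  => [S|S _ _ [x <-] [x' <-]|S T g _ [x <-]].
- by exists 0; rewrite raddf0.
- by exists (x - x'); rewrite raddfB.
- by exists (FImap V g x); rewrite FIhom_nat.
Defined.

Lemma mem_kerFI (S : finType) x : (x \in kerFI S) <-> f S x = 0.
Proof. exact: mem_mk_FIsub. Qed.

Lemma mem_imFI (S : finType) y : (y \in imFI S) <-> exists x, f S x = y.
Proof. exact: mem_mk_FIsub. Qed.

Definition coker : FImod := quotFI imFI.

End KerIm.

Definition FIepi (V W : FImod) (f : FIhom V W) :=
  forall (S : finType) (y : W S), exists x, f S x = y.

Definition exact_at (U V W : FImod) (f : FIhom U V) (g : FIhom V W) :=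
  forall (S : finType) (y : V S), g S y = 0 <-> exists x, f S x = y.

Section Homology.
Variables (U V W : FImod) (f : FIhom U V) (g : FIhom V W).

Definition boundaries : FIsub (subFI (kerFI g)).
Proof.
apply: (@mk_FIsub (subFI (kerFI g)) (fun S z => exists x, f S x = sub_incl _ S z))
  => [S|S y z [x fx] [x' fx']|S T h z [x fx]].
- by exists 0; rewrite !raddf0.
- by exists (x - x'); rewrite !raddfB fx fx'.
- by exists (FImap U h x); rewrite !FIhom_nat fx.
Defined.

Definition homology : FImod := quotFI boundaries.

End Homology.

Section Shift.
Variable V : FImod.

Lemma shift_id (S : finType) x : FImap V (FIoption (FIid S)) x = x.
Proof.
rewrite -[RHS](FImap_id (x : V (option S))); congr (FImap V _ x).
by apply: FIinjP => -[a|]; rewrite !FIE /= ?FIE.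
Qed.

Lemma shift_comp (S T U : finType) (g : FIinj T U) (f : FIinj S T) x :
  FImap V (FIoption (FIcomp g f)) x = FImap V (FIoption g) (FImap V (FIoption f) x).
Proof.
rewrite -FImap_comp; congr (FImap V _ x).
by apply: FIinjP => -[a|]; rewrite !FIE /= ?FIE.
Qed.

Definition Shift : FImod :=
  @FIMod (fun S => V (option S)) (fun S T f => FImap V (FIoption f))
    shift_id shift_comp.

Definition to_shift : FIhom V Shift.
Proof.
apply: (@FIHom V Shift (fun S => FImap V (FIsome S))) => S T f x.
rewrite /= -!FImap_comp; congr (FImap V _ x).
by apply: FIinjP => a; rewrite !FIE ?mk_injE.
Defined.

Definition Delta : FImod := coker to_shift.

End Shift.

Definition torsion (V : FImod) :=
  forall (S : finType) (x : V S), exists (T : finType) (f : FIinj S T), FImap V f x = 0.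

Section Torsion.
Variable V : FImod.

Lemma torsion_subP (N : FIsub V) : torsion (subFI N) <->
  forall (S : finType) x, x \in N S -> exists (T : finType) (f : FIinj S T), FImap V f x = 0.
Proof.
split=> tN S x => [Nx|].
  by have [T [f /(congr1 val) fx]] := tN S (exist _ x Nx); exists T, f.
by have [T [f fx]] := tN S _ (valP x); exists T, f; apply: val_inj.
Qed.

Definition sub_add (N P : FIsub V) : FIsub V.
Proof.
apply: (@mk_FIsub V (fun S z => exists x y, [/\ x \in N S, y \in P S & z = x + y])).
- by move=> S; exists 0; exists 0; rewrite !rpred0 addr0; split.
- move=> S _ _ [x [y [Nx Py ->]]] [x' [y' [Nx' Py' ->]]].
  by exists (x - x'), (y - y'); rewrite !rpredB // opprD addrACA.
- move=> S T f _ [x [y [Nx Py ->]]].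
  by exists (FImap V f x), (FImap V f y); rewrite raddfD !FIsub_stable.
Defined.

Lemma torsion_sub_add (N P : FIsub V) :
  torsion (subFI N) -> torsion (subFI P) -> torsion (subFI (sub_add N P)).
Proof.
move=> /torsion_subP tN /torsion_subP tP; apply/torsion_subP => S z.
move=> /mem_mk_FIsub[x [y [Nx Py ->]]]; have [T [f fx]] := tN S x Nx.
have [U [g gy]] := tP T _ (FIsub_stable f Py).
by exists U, (FIcomp g f); rewrite FImap_comp !raddfD fx gy raddf0 addr0.
Qed.

Definition zero_sub : FIsub V.
Proof.
apply: (@mk_FIsub V (fun S x => x = 0)) => [|S x y -> ->|S T f x ->] //.
- by rewrite subr0.
- exact: raddf0.
Defined.

(* The union of all torsion submodules, which is again one: see
   [torsion_part_torsion] and [torsion_part_largest]. *)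
Definition torsion_part : FIsub V.
Proof.
apply: (@mk_FIsub V (fun S x => exists2 N : FIsub V, torsion (subFI N) & x \in N S)).
- move=> S; exists zero_sub; last exact: rpred0.
  apply/torsion_subP => S' x /mem_mk_FIsub ->.
  by exists S', (FIid S'); rewrite raddf0.
- move=> S x y [N tN Nx] [P tP Py]; exists (sub_add N P); first exact: torsion_sub_add.
  by apply/mem_mk_FIsub; exists x, (- y); rewrite rpredN.
- by move=> S T f x [N tN Nx]; exists N => //; apply: FIsub_stable.
Defined.

Definition H0m : FImod := subFI torsion_part.

Lemma torsion_part_torsion : torsion H0m.
Proof.
by apply/torsion_subP => S x /mem_mk_FIsub[N /torsion_subP tN Nx]; apply: tN.
Qed.

Lemma torsion_part_largest (N : FIsub V) : torsion (subFI N) ->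
  forall (S : finType) x, x \in N S -> x \in torsion_part S.
Proof. by move=> tN S x Nx; apply/mem_mk_FIsub; exists N. Qed.

End Torsion.

Section HFI0.
Variable V : FImod.

(* The image of the sum over proper subsets [A] of [S] of the [V A]. *)
Definition from_proper (S : finType) (x : V S) :=
  exists y : forall A : {set S}, V {s : S | s \in A},
    x = \sum_(A : {set S} | A \proper [set: S]%SET) FImap V (FIincl A) (y A).

Lemma from_proper0 (S : finType) : from_proper (0 : V S).
Proof. by exists (fun A => 0); rewrite big1 // => A _; rewrite raddf0. Qed.

Lemma from_properB (S : finType) (x x' : V S) :
  from_proper x -> from_proper x' -> from_proper (x - x').
Proof.
move=> [y ->] [y' ->]; exists (fun A => y A - y' A).
by rewrite -sumrB; apply: eq_bigr => A _; rewrite raddfB.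
Qed.

Lemma from_properD (S : finType) (x x' : V S) :
  from_proper x -> from_proper x' -> from_proper (x + x').
Proof.
move=> Px Px'; rewrite -[x']opprK -[- x']sub0r.
by apply: from_properB => //; apply: from_properB => //; apply: from_proper0.
Qed.

Lemma from_proper1 (S : finType) (A : {set S}) (y : V {s : S | s \in A}) :
  A \proper [set: S]%SET -> from_proper (FImap V (FIincl A) y).
Proof.
move=> pA; exists (fun B => if A =P B is ReflectT AB then
  ecast B (V {s : S | s \in B}) AB y else 0).
rewrite (bigD1 A) //= big1 ?addr0.
  by case: eqP => // AA; rewrite (eq_axiomK AA).
move=> B /andP[_ BA]; case: eqP => [AB|_]; last by rewrite raddf0.
by rewrite AB eqxx in BA.
Qed.

Definition proper_sub : FIsub V.
Proof.
apply: (mk_FIsub from_proper0 from_properB) => S T f _ [y ->]; rewrite raddf_sum.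
apply: big_rec; first exact: from_proper0.
move=> A z pA Pz; apply: from_properD => //.
have fA (a : {s : S | s \in A}) : f (val a) \in (f @: A)%SET.
  by apply: imset_f; apply: valP.
pose h (a : {s : S | s \in A}) : {t : T | t \in (f @: A)%SET} := Sub (f (val a)) (fA a).
have hI : injective h by move=> a b [/FIinj_inj/val_inj].
have -> : FImap V f (FImap V (FIincl A) (y A)) =
    FImap V (FIincl (f @: A)%SET) (FImap V (mk_inj hI) (y A)).
  rewrite -!FImap_comp; congr (FImap V _ _).
  by apply: FIinjP => a; rewrite !FIE ?mk_injE.
apply: from_proper1; rewrite properE finset.subsetT /=.
have /fintype.properP[_ [s _ sA]] := pA; apply/fintype.subsetPn; exists (f s); first exact: finset.in_setT.
by apply: contra sA => /imsetP[s' s'A /FIinj_inj ->].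
Defined.

Definition HFI0 : FImod := quotFI proper_sub.

End HFI0.

Section HFI0Map.
Variables (V W : FImod) (f : FIhom V W).

Lemma HFI0_map_subproof (S : finType) x :
  x \in proper_sub V S -> (quot_pi (proper_sub W) S \o f S) x = 0.
Proof.
move=> /mem_mk_FIsub[y ->]; apply/quot_pi_eq0/mem_mk_FIsub.
exists (fun A => f _ (y A)); rewrite raddf_sum.
by apply: eq_bigr => A _; rewrite FIhom_nat.
Qed.

Definition HFI0_map : FIhom (HFI0 V) (HFI0 W).
Proof.
apply: (@FIHom (HFI0 V) (HFI0 W)
  (fun S => quot_lift (@HFI0_map_subproof S))) => S T h q.
rewrite -[q]quot_pi_repr quotFI_map_pi.
transitivity (quot_pi (proper_sub W) T (f T (FImap V h (repr q)))).
  exact: quot_lift_pi.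
rewrite FIhom_nat -quotFI_map_pi; apply: (congr1 (FImap (HFI0 W) h)).
by symmetry; apply: quot_lift_pi.
Defined.

Lemma HFI0_map_pi (S : finType) x :
  HFI0_map S (quot_pi (proper_sub V) S x) = quot_pi (proper_sub W) S (f S x).
Proof. exact: quot_lift_pi. Qed.

End HFI0Map.

Definition projective (P : FImod) :=
  forall (V W : FImod) (p : FIhom V W) (f : FIhom P W), FIepi p ->
  exists g : FIhom P V, forall (S : finType) x, p S (g S x) = f S x.

Record proj_resolution (V : FImod) := ProjResolution {
  res_obj :> nat -> FImod;
  res_d : forall n, FIhom (res_obj n.+1) (res_obj n);
  res_aug : FIhom (res_obj 0%N) V;
  res_proj : forall n, projective (res_obj n);
  res_aug_epi : FIepi res_aug;
  res_exact0 : exact_at (res_d 0) res_aug;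
  res_exactS : forall n, exact_at (res_d n.+1) (res_d n) }.

Definition res_homology (V : FImod) (P : proj_resolution V) (i : nat) : FImod :=
  match i with
  | 0 => coker (HFI0_map (res_d P 0))
  | j.+1 => homology (HFI0_map (res_d P j.+1)) (HFI0_map (res_d P j))
  end.

(* The free FI-module with one generator in degree [n] for each element of
   [V 'I_n], over all [n]; it is projective and maps onto [V]. *)
Section FreeCover.
Variable V : FImod.

Definition free_idx (S : finType) : choiceType :=
  {n : nat & (V 'I_n * FIinj 'I_n S)%type}.

Definition idx (S : finType) n (v : V 'I_n) (i : FIinj 'I_n S) : free_idx S :=
  Tagged (fun n => (V 'I_n * FIinj 'I_n S)%type) (v, i).

Definition free_push (S T : finType) (f : FIinj S T) (k : free_idx S) : free_idx T :=
  idx (tagged k).1 (FIcomp f (tagged k).2).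

Definition free_obj (S : finType) : zmodType := freeZ (free_idx S).

Definition free_map (S T : finType) (f : FIinj S T) :
    {additive free_obj S -> free_obj T} :=
  freeZ_lift (fun k => freeZ_gen (free_push f k)).

Arguments free_map : simpl never.

Lemma free_map_gen (S T : finType) (f : FIinj S T) k :
  free_map f (freeZ_gen k) = freeZ_gen (free_push f k).
Proof. exact: freeZ_lift_gen. Qed.

Lemma free_map_id (S : finType) x : free_map (FIid S) x = x.
Proof.
apply: (freeZ_ext (f := free_map (FIid S)) (g := idfun)) => -[n [v i]].
rewrite free_map_gen /free_push /=; congr (freeZ_gen (idx v _)).
by apply: FIinjP => a; rewrite !FIE ?mk_injE.
Qed.

Lemma free_map_comp (S T U : finType) (g : FIinj T U) (f : FIinj S T) x :
  free_map (FIcomp g f) x = free_map g (free_map f x).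
Proof.
apply: (freeZ_ext (f := free_map (FIcomp g f)) (g := free_map g \o free_map f)).
move=> -[n [v i]]; rewrite free_map_gen.
transitivity (free_map g (free_map f (freeZ_gen (idx v i)))) => //.
rewrite !free_map_gen /free_push /=; congr (freeZ_gen (idx v _)).
by apply: FIinjP => a; rewrite !FIE ?mk_injE.
Qed.

Definition free_cover : FImod := FIMod free_map_id free_map_comp.

Definition free_hom_at (W : FImod) (h : forall n, V 'I_n -> W 'I_n) (S : finType) :
    {additive free_cover S -> W S} :=
  freeZ_lift (fun k : free_idx S => FImap W (tagged k).2 (h (tag k) (tagged k).1)).

Lemma free_hom_nat (W : FImod) h (S T : finType) (f : FIinj S T) x :
  free_hom_at h T (FImap free_cover f x) = FImap W f (free_hom_at h S x).
Proof.
apply: (freeZ_ext (f := free_hom_at h T \o FImap free_cover f)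
  (g := FImap W f \o free_hom_at h S)) => -[n [v i]].
transitivity (free_hom_at h T (FImap free_cover f (freeZ_gen (idx v i)))) => //.
transitivity (FImap W f (free_hom_at h S (freeZ_gen (idx v i)))) => //.
by rewrite [FImap _ _ _]free_map_gen /free_hom_at !freeZ_lift_gen /= FImap_comp.
Qed.

Definition free_hom (W : FImod) (h : forall n, V 'I_n -> W 'I_n) : FIhom free_cover W :=
  FIHom (free_hom_nat h).

Lemma free_homE (W : FImod) (h : forall n, V 'I_n -> W 'I_n) (S : finType) n v i :
  free_hom h S (freeZ_gen (idx v i)) = FImap W i (h n v).
Proof. exact: freeZ_lift_gen. Qed.

Lemma free_cover_projective : projective free_cover.
Proof.
move=> A B p f p_epi.
pose b n (v : V 'I_n) : B 'I_n := f 'I_n (freeZ_gen (idx v (FIid 'I_n))).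
pose a n (v : V 'I_n) : A 'I_n := projT1 (cid (p_epi 'I_n (b n v))).
have pa n v : p _ (a n v) = b n v by rewrite /a; case: cid.
exists (free_hom a) => S x.
apply: (freeZ_ext (f := p S \o free_hom a S) (g := f S)) => -[n [v i]].
rewrite /= [X in p S X]free_homE FIhom_nat pa -FIhom_nat [X in f S X]free_map_gen.
rewrite /free_push /=; congr (f S (freeZ_gen (idx v _))).
by apply: FIinjP => c; rewrite !FIE ?mk_injE.
Qed.

Definition free_aug : FIhom free_cover V := free_hom (fun n v => v).

Lemma free_aug_epi : FIepi free_aug.
Proof.
move=> S x; pose e : FIinj 'I_#|S| S := mk_inj (@enum_val_inj S S).
pose r : FIinj S 'I_#|S| := mk_inj (@enum_rank_inj S).
exists (freeZ_gen (idx (FImap V r x) e)); rewrite free_homE -FImap_comp.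
rewrite -[RHS]FImap_id; congr (FImap V _ x).
by apply: FIinjP => s; rewrite !FIE ?mk_injE enum_rankK.
Qed.

End FreeCover.

Section StdResolution.
Variable V : FImod.

Definition FIhom_comp (A B C : FImod) (g : FIhom B C) (f : FIhom A B) : FIhom A C.
Proof.
by apply: (@FIHom A C (fun S => g S \o f S)) => S T h x; rewrite /= !FIhom_nat.
Defined.

(* Stage [n] is a morphism [d : P -> W]; stage [n.+1] is the free cover of
   [ker d] followed by the inclusion into [P]. *)
Record stage := Stage { stage_dom : FImod; stage_cod : FImod;
                        stage_hom : FIhom stage_dom stage_cod }.

Definition next_stage (s : stage) : stage :=
  Stage (FIhom_comp (sub_incl (kerFI (stage_hom s)))
                    (free_aug (subFI (kerFI (stage_hom s))))).

Fixpoint std_stage (n : nat) : stage :=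
  if n is n'.+1 then next_stage (std_stage n') else Stage (free_aug V).

Lemma std_projective n : projective (stage_dom (std_stage n)).
Proof. by case: n => [|n]; apply: free_cover_projective. Qed.

Lemma next_stage_exact (s : stage) :
  exact_at (stage_hom (next_stage s) : FIhom _ (stage_dom s)) (stage_hom s).
Proof.
move=> S y; split=> [/mem_kerFI ky|[x <-]]; last exact/mem_kerFI/(valP (free_aug _ S x)).
have [x xy] := free_aug_epi (exist _ y ky : subFI (kerFI (stage_hom s)) S).
by exists x; have /= := congr1 val xy.
Qed.

Definition std_resolution : proj_resolution V :=
  @ProjResolution V (fun n => stage_dom (std_stage n))
    (fun n => stage_hom (std_stage n.+1)) (stage_hom (std_stage 0))
    std_projective (@free_aug_epi V)
    (@next_stage_exact (std_stage 0)) (fun n => @next_stage_exact (std_stage n.+1)).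

End StdResolution.

(* Left derived functors of [HFI0]; another choice of projective resolution
   gives isomorphic modules. *)
Definition HFI (i : nat) (V : FImod) : FImod := res_homology (std_resolution V) i.

(* The minimum and the maximum of [A], or [+oo] when it does not exist. *)
Definition emin (A : set (\bar int)) : \bar int := xget +oo%E [set x | A x /\ lbound A x].
Definition emax (A : set (\bar int)) : \bar int := xget +oo%E [set x | A x /\ ubound A x].

Definition deg (W : FImod) : \bar int :=
  emin [set (d%:E)%E | d in [set d : int | -1 <= d /\
    forall S : finType, d < #|S|%:Z -> forall x : W S, x = 0]].

Definition h0 (V : FImod) : \bar int := deg (H0m V).

Definition delta (V : FImod) : \bar int :=
  emin [set (r%:E)%E | r in [set r : int | -1 <= r /\
    torsion (iter (absz (r + 1)) Delta V)]].

Definition t_ (i : nat) (V : FImod) : \bar int := deg (HFI i V).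

Definition reg (V : FImod) : \bar int :=
  emax [set (t_ i V - i%:Z%:E)%E | i in [set i | (1 <= i)%N]].

(* Recursion on [k = r + 1]. *)
Fixpoint Poly2_rec (k : nat) (M : int) (V : FImod) : Prop :=
  if k is k'.+1
  then (h0 V <= (M - 1)%:E)%E /\ Poly2_rec k' (Num.max 0 (M - 1)) (Delta V)
  else (deg V <= (M - 1)%:E)%E.

(* Meaningful for [-1 <= r] only. *)
Definition Poly2 (r M : int) (V : FImod) : Prop := Poly2_rec (absz (r + 1)) M V.

(* Main.v *)
From HB Require Import structures.
Require Import Defs.
From mathcomp Require Import all_boot all_order all_algebra.
From mathcomp Require Import constructive_ereal.
From mathcomp Require Import boolp classical_sets.
From mathcomp Require Import zify.

(* [proper_sub] also names a lemma on finite predicates. *)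
Import Defs.

Set Implicit Arguments.
Unset Strict Implicit.
Unset Printing Implicit Defensive.

Import Order.TTheory GRing.Theory Num.Theory.

Local Open Scope ring_scope.

(** Let K_n(V) be the Koszul complex of V at a set of n elements: its chains of
    degree i are families of elements of V_A, where A runs over the subsets
    whose complement has i elements, twisted by the sign of that complement.
    Its homology is the FI-homology of V.  Sorting the A according to whether
    they contain a chosen point shows that K_(n+1)(V) is the mapping cone of
    K_n(V) -> K_n(Shift V), and this is taken as the definition of [kos] below:
    no set has to be ordered, and the only sign left is that of a cone.  Write H_i(V)_n for the
    homology; [acyclic n i V] says that it vanishes.

    Three facts about it give the theorem.
    - If V -> Shift V is injective, the cone computes the homology of the
      cokernel, so H_i(V)_(n+1) = H_i(Delta V)_n ([acyclic_Delta]).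
    - If V vanishes on sets of at least M elements, there are no chains of
      degree i as soon as n >= M + i ([acyclic_deg_lt]), so reg V <= M - 1.
    - Conversely reg V <= M - 1 forces ker(V -> Shift V), and hence every
      torsion element, to vanish on sets of at least M elements.  A nonzero
      element of that kernel at a set of d elements, put on one summand of the
      complex, is a cycle of degree d + 1 in K_(2d+1)(V); a map that sums over
      the transversals of d disjoint pairs of points kills all boundaries but
      not this cycle ([reg_lt_ker_shift]).

    Let T be the torsion part of V and V' = V/T.  Then V' -> Shift V' is
    injective, so 0 -> Delta T -> Delta V -> Delta V' -> 0 is exact, and the long
    exact sequences carry bounds on the regularity between V and Delta V: the
    terms coming from T are controlled by its degree.  An induction on r then
    matches the recursive definition of Poly_2 with the bound on the regularity;
    the condition on the stable degree follows along because Delta^(r+1) V is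
    Delta^r (Delta V) ([Poly2_rec_reg], [reg_Poly2_rec]).

    That the complex does compute FI-homology ([HFI_acyclic]) follows by
    dimension shifting along the standard resolution: the free modules in it are
    acyclic because V -> Shift V is naturally split for them
    ([acyclic_split], [free_cover_split]), and the last step compares the
    boundaries of degree 0 with the submodule by which [HFI0] divides
    ([kos_top_boundary]). *)

(** * The Koszul complex *)

Definition trivial_at (W : FImod) (S : finType) := forall x : W S, x = 0.

Record short_exact (A B C : FImod) (f : FIhom A B) (g : FIhom B C) : Prop := {
  short_exact_inj : forall S : finType, injective (f S);
  short_exact_mid : exact_at f g;
  short_exact_epi : FIepi g }.

Definition Shift_hom (V W : FImod) (f : FIhom V W) : FIhom (Shift V) (Shift W).
Proof.
apply: (@FIHom (Shift V) (Shift W) (fun S => f (option S))) => S T h x.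
exact: (FIhom_nat f (FIoption h) x).
Defined.

(** The sum of all the chain groups of the complex at n points, the chosen point
    being the last one added: the two factors of [kos n.+1 V] collect the subsets
    that contain it and those that do not.  The grading is the predicate
    [kos_deg] below, which avoids types indexed by a degree. *)
Fixpoint kos (n : nat) (V : FImod) : zmodType :=
  if n is m.+1 then (kos m (Shift V) * kos m V)%type : zmodType else V void.

Fixpoint kos_map_fun n (V W : FImod) (f : FIhom V W) : kos n V -> kos n W :=
  if n is m.+1 return kos n V -> kos n W
  then fun x => (kos_map_fun (Shift_hom f) x.1, kos_map_fun f x.2)
  else f void.

Lemma kos_map_subproof n (V W : FImod) (f : FIhom V W) :
  zmod_morphism (@kos_map_fun n V W f).
Proof.
elim: n V W f => [|n IH] V W f x y /=; first exact: raddfB.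
by congr pair; apply: IH.
Qed.

(** Locked, as is the differential below, so that simplification does not run
    through the recursion on [n]. *)
HB.lock Definition kos_map n (V W : FImod) (f : FIhom V W) : {additive kos n V -> kos n W} :=
  mk_additive (@kos_map_subproof n V W f).

Lemma kos_map0 (V W : FImod) (f : FIhom V W) (x : kos 0 V) : kos_map 0 f x = f void x.
Proof. by rewrite kos_map.unlock. Qed.

Lemma kos_mapS n (V W : FImod) (f : FIhom V W) (u : kos n (Shift V)) (p : kos n V) :
  kos_map n.+1 f (u, p) = (kos_map n (Shift_hom f) u, kos_map n f p).
Proof. by rewrite !kos_map.unlock. Qed.

Lemma eq_kos_map n (V W : FImod) (f g : FIhom V W) :
  (forall (S : finType) x, f S x = g S x) -> kos_map n f =1 kos_map n g.
Proof.
elim: n V W f g => [|n IH] V W f g fg => [x|[u p]]; first by rewrite !kos_map0 fg.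
by rewrite !kos_mapS; congr pair; apply: IH => // S y; apply: fg.
Qed.

Lemma kos_map_comp n (U V W : FImod) (g : FIhom V W) (f : FIhom U V) x :
  kos_map n g (kos_map n f x) = kos_map n (FIhom_comp g f) x.
Proof.
elim: n U V W g f x => [|n IH] U V W g f => [x|[u p]]; first by rewrite !kos_map0.
rewrite !kos_mapS !IH.
by congr pair; apply: eq_kos_map.
Qed.

Lemma kos_map_eq0 n (V W : FImod) (f : FIhom V W) x :
  (forall (S : finType) x, f S x = 0) -> kos_map n f x = 0.
Proof.
elim: n V W f x => [|n IH] V W f => [x|[u p]] f0; first by rewrite kos_map0 f0.
by rewrite kos_mapS !IH // => S y; apply: f0.
Qed.

Fixpoint kos_d_fun n (V : FImod) : kos n V -> kos n V :=
  if n is m.+1 return kos n V -> kos n V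
  then fun x => (kos_d_fun x.1 + kos_map m (to_shift V) x.2, - kos_d_fun x.2)
  else fun _ => 0.

Lemma kos_d_subproof n (V : FImod) : zmod_morphism (@kos_d_fun n V).
Proof.
elim: n V => [|n IH] V => [x y|[u p] [v q]] /=; first by rewrite subr0.
congr pair; first by rewrite IH raddfB /= opprD addrACA.
by rewrite IH /= opprB opprK addrC.
Qed.

HB.lock Definition kos_d n (V : FImod) : {additive kos n V -> kos n V} :=
  mk_additive (@kos_d_subproof n V).

Lemma kos_d0 (V : FImod) (x : kos 0 V) : kos_d 0 V x = 0.
Proof. by rewrite kos_d.unlock. Qed.

Lemma kos_dS n (V : FImod) (u : kos n (Shift V)) (p : kos n V) :
  kos_d n.+1 V (u, p) =
  (kos_d n (Shift V) u + kos_map n (to_shift V) p, - kos_d n V p).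
Proof. by rewrite !kos_d.unlock. Qed.

Lemma kos_d_map n (V W : FImod) (f : FIhom V W) x :
  kos_d n W (kos_map n f x) = kos_map n f (kos_d n V x).
Proof.
elim: n V W f x => [|n IH] V W f => [x|[u p]]; first by rewrite !kos_d0 raddf0.
rewrite !(kos_dS, kos_mapS, kos_dS) !IH raddfN raddfD; congr (_ + _, _).
rewrite !kos_map_comp; apply: eq_kos_map => S y.
by rewrite /= FIhom_nat.
Qed.

Lemma kos_dd n (V : FImod) x : kos_d n V (kos_d n V x) = 0.
Proof.
elim: n V x => [|n IH] V => [x|[u p]]; first by rewrite !kos_d0.
rewrite !kos_dS raddfD (raddfN (kos_d n V)) (raddfN (kos_map n _)) !IH !oppr0.
by rewrite add0r kos_d_map subrr.
Qed.

(** Degrees are integers, so that no chain but 0 in the negative ones replaces a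
    separate treatment of degree 0. *)
Fixpoint kos_deg n (V : FImod) (i : int) : kos n V -> Prop :=
  if n is m.+1 return kos n V -> Prop
  then fun x => kos_deg i x.1 /\ kos_deg (i - 1) x.2
  else fun x => i = 0 \/ x = 0.

Lemma kos_deg0 n (V : FImod) i : kos_deg i (0 : kos n V).
Proof. by elim: n V i => [|n IH] V i /=; [right|split; apply: IH]. Qed.

Lemma kos_degB n (V : FImod) i (x y : kos n V) :
  kos_deg i x -> kos_deg i y -> kos_deg i (x - y).
Proof.
elim: n V i x y => [|n IH] V i x y /=; last by case=> ? ? [? ?]; split; apply: IH.
case=> [->|->]; first by left.
by case=> [->|->]; [left|right; rewrite subrr].
Qed.

Lemma kos_degN n (V : FImod) i (x : kos n V) : kos_deg i x -> kos_deg i (- x).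
Proof. by rewrite -sub0r => ?; apply: kos_degB => //; apply: kos_deg0. Qed.

Lemma kos_degD n (V : FImod) i (x y : kos n V) :
  kos_deg i x -> kos_deg i y -> kos_deg i (x + y).
Proof. by move=> dx dy; rewrite -[y]opprK; apply: kos_degB => //; apply: kos_degN. Qed.

Lemma kos_deg_map n (V W : FImod) (f : FIhom V W) i x :
  kos_deg i x -> kos_deg i (kos_map n f x).
Proof.
elim: n V W f i x => [|n IH] V W f i => [x|[u p]].
  by case=> [->|->]; [left|right; rewrite raddf0].
by rewrite kos_mapS => -[? ?]; split; apply: IH.
Qed.

Lemma kos_deg_d n (V : FImod) i x : kos_deg i x -> kos_deg (i - 1) (kos_d n V x).
Proof.
elim: n V i x => [|n IH] V i => [x|[u p]]; first by rewrite kos_d0; right.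
rewrite kos_dS => -[du dp]; split; last by apply/kos_degN/IH.
by apply: kos_degD; [apply: IH|apply: kos_deg_map].
Qed.

Lemma kos_deg_lt0 n (V : FImod) i (x : kos n V) : i < 0 -> kos_deg i x -> x = 0.
Proof.
elim: n V i x => [|n IH] V i x i0 /=; first by case=> // i00; rewrite i00 in i0.
case: x => x1 x2 /= [/IH -> // /IH -> //]; lia.
Qed.

Lemma kos_map_inj n (V W : FImod) (f : FIhom V W) :
  (forall S : finType, injective (f S)) -> injective (kos_map n f).
Proof.
elim: n V W f => [|n IH] V W f fI.
  by move=> x y; rewrite !kos_map0 => /fI.
move=> [x1 x2] [y1 y2]; rewrite !kos_mapS => -[e1 e2].
by congr pair; [apply: IH e1 => S; apply: fI|apply: IH e2].
Qed.

Lemma kos_map_epi n (V W : FImod) (f : FIhom V W) i y : FIepi f -> kos_deg i y ->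
  exists2 x, kos_deg i x & kos_map n f x = y.
Proof.
elim: n V W f i y => [|n IH] V W f i y fE.
  case=> [->|->]; last by exists 0; [apply: kos_deg0|apply: raddf0].
  by have [x fx] := fE _ y; exists x; rewrite ?kos_map0 //; left.
case: y => y1 y2 [/= d1 d2].
have [x1 dx1 e1] := IH _ _ (Shift_hom f) _ _ (fun S => fE (option S)) d1.
have [x2 dx2 e2] := IH _ _ _ _ _ fE d2.
by exists (x1, x2); rewrite ?kos_mapS ?e1 ?e2.
Qed.

Lemma kos_map_exact n (A B C : FImod) (f : FIhom A B) (g : FIhom B C) i y :
  exact_at f g -> kos_deg i y -> kos_map n g y = 0 ->
  exists2 x, kos_deg i x & kos_map n f x = y.
Proof.
elim: n A B C f g i y => [|n IH] A B C f g i y fg.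
  case=> [->|->]; last by exists 0; [apply: kos_deg0|apply: raddf0].
  by rewrite kos_map0 => /fg[x fx]; exists x; rewrite ?kos_map0 //; left.
case: y => y1 y2 [/= d1 d2]; rewrite kos_mapS => -[g1 g2].
have fgS : exact_at (Shift_hom f) (Shift_hom g) by move=> S; apply: fg.
have [x1 dx1 e1] := IH _ _ _ _ _ _ _ fgS d1 g1.
have [x2 dx2 e2] := IH _ _ _ _ _ _ _ fg d2 g2.
by exists (x1, x2); rewrite ?kos_mapS ?e1 ?e2.
Qed.

(** * Vanishing of homology and long exact sequences *)

Definition acyclic (n : nat) (i : int) (V : FImod) : Prop :=
  forall x, kos_deg i x -> kos_d n V x = 0 ->
  exists2 y, kos_deg (i + 1) y & kos_d n V y = x.

Section LongExact.
Variables (A B C : FImod) (f : FIhom A B) (g : FIhom B C).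
Hypothesis fg : short_exact f g.
Variable n : nat.

Let F : {additive kos n A -> kos n B} := kos_map n f.
Let G : {additive kos n B -> kos n C} := kos_map n g.

Let Finj : injective F. Proof. exact/kos_map_inj/(short_exact_inj fg). Qed.
Let GF x : G (F x) = 0.
Proof.
rewrite /G /F kos_map_comp; apply: kos_map_eq0 => S y.
by apply/(short_exact_mid fg); exists y.
Qed.
Let Fex i y : kos_deg i y -> G y = 0 -> exists2 x, kos_deg i x & F x = y.
Proof. exact/kos_map_exact/(short_exact_mid fg). Qed.
Let Gepi i y : kos_deg i y -> exists2 x, kos_deg i x & G x = y.
Proof. exact/kos_map_epi/(short_exact_epi fg). Qed.

Lemma acyclic_mid i : acyclic n i A -> acyclic n i C -> acyclic n i B.
Proof.
move=> HA HC x dx x0.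
have [|c dc ec] := HC (G x) (kos_deg_map _ dx); first by rewrite kos_d_map x0 raddf0.
have [b db eb] := Gepi dc.
have dxb : kos_deg i (x - kos_d n B b).
  by apply: kos_degB => //; have := kos_deg_d db; rewrite addrK.
have [|a da ea] := Fex dxb; first by rewrite raddfB /G -kos_d_map eb ec subrr.
have [|a' da' ea'] := HA a da.
  by apply: Finj; rewrite raddf0 /F -kos_d_map ea raddfB x0 kos_dd subr0.
exists (b + F a'); first by apply: kos_degD => //; apply: kos_deg_map.
by rewrite raddfD kos_d_map ea' ea addrC subrK.
Qed.

(** This is injectivity of H_i(A) -> H_i(B), from the vanishing of H_{i+1}(C). *)
Lemma boundary_reflect i a : acyclic n (i + 1) C -> kos_deg i a ->
  (exists2 b, kos_deg (i + 1) b & kos_d n B b = F a) ->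
  exists2 a', kos_deg (i + 1) a' & kos_d n A a' = a.
Proof.
move=> HC dx [b db eb].
have [||c dc ec] := HC (G b); first exact: kos_deg_map.
  by rewrite kos_d_map eb GF.
have [b' db' eb'] := Gepi dc.
have [||a' da ea] := @Fex (i + 1) (b - kos_d n B b').
- by apply: kos_degB => //; have := kos_deg_d db'; rewrite addrK.
- by rewrite raddfB /G -kos_d_map eb' ec subrr.
exists a' => //; apply: Finj.
by rewrite /F -kos_d_map ea raddfB kos_dd subr0 eb.
Qed.

Lemma acyclic_left i : acyclic n i B -> acyclic n (i + 1) C -> acyclic n i A.
Proof.
move=> HB HC x dx x0; apply: boundary_reflect => //; apply: HB.
  exact: kos_deg_map.
by rewrite kos_d_map x0 raddf0.
Qed.

Lemma acyclic_right_inj i : acyclic n i B ->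
  (forall a, kos_deg (i - 1) a ->
     (exists2 b, kos_deg i b & kos_d n B b = F a) ->
     exists2 a', kos_deg i a' & kos_d n A a' = a) ->
  acyclic n i C.
Proof.
move=> HB HA x dx x0; have [b db eb] := Gepi dx.
have [|a da ea] := Fex (kos_deg_d db); first by rewrite /G -kos_d_map eb.
have [|a' da' ea'] := HA a da; first by exists b.
have [||b' db' eb'] := HB (b - F a').
- by apply: kos_degB => //; apply: kos_deg_map.
- by rewrite raddfB kos_d_map ea' ea subrr.
exists (G b'); first exact: kos_deg_map.
by rewrite kos_d_map eb' raddfB GF subr0.
Qed.

Lemma acyclic_right i : acyclic n i B -> acyclic n (i - 1) A -> acyclic n i C.
Proof.
move=> HB HA; apply: acyclic_right_inj => // a da [b _ eb].
have [|a' da' ea'] := HA a da.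
  by apply: Finj; rewrite raddf0 /F -kos_d_map -/F -eb kos_dd.
by exists a' => //; rewrite subrK in da'.
Qed.

(** The first homology of [C] is the kernel of H_0(A) -> H_0(B) as soon as that
    of [B] vanishes; it is what compares the complex with [HFI]. *)
Lemma acyclic1_quot : acyclic n 1 B ->
  (acyclic n 1 C <->
   forall x, kos_deg 0 x -> (exists2 y, kos_deg 1 y & kos_d n B y = F x) ->
     exists2 y, kos_deg 1 y & kos_d n A y = x).
Proof.
move=> HB; split=> [HC x|HA]; first exact: (@boundary_reflect 0).
by apply: (acyclic_right_inj HB); rewrite subrr.
Qed.

End LongExact.

(** * The mapping cone of an injective shift map *)

Lemma Delta_short_exact (V : FImod) : (forall S : finType, injective (to_shift V S)) ->
  short_exact (to_shift V) (quot_proj (imFI (to_shift V))).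
Proof.
move=> iI; split=> //.
- by move=> S y; rewrite [X in X <-> _]quot_pi_eq0 mem_imFI.
- by move=> S y; exists (repr y); apply: quot_pi_repr.
Qed.

(** [kos n.+1 V] is the cone of an injective map of complexes whose cokernel is
    [kos n (Delta V)], and such a cone is quasi-isomorphic to the cokernel. *)
Lemma acyclic_Delta n i (V : FImod) : (forall S : finType, injective (to_shift V S)) ->
  acyclic n.+1 i V <-> acyclic n i (Delta V).
Proof.
move=> iI; have ex := Delta_short_exact iI.
pose F := kos_map n (to_shift V); pose G := kos_map n (quot_proj (imFI (to_shift V))).
have FI : injective F by apply: kos_map_inj.
have GF x : G (F x) = 0.
  rewrite /G /F kos_map_comp; apply: kos_map_eq0 => S y.
  by apply/(short_exact_mid ex); exists y.
have Fex j y := @kos_map_exact n _ _ _ _ _ j y (short_exact_mid ex).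
have Gepi j y := @kos_map_epi n _ _ _ j y (short_exact_epi ex).
split=> [HV z dz z0|HD [u p] [/= du dp]].
  have [u du eu] := Gepi _ _ dz.
  have [|p dp ep] := Fex _ _ (kos_deg_d du); first by rewrite -kos_d_map eu z0.
  have [||[u' p'] [du' dp']] := HV (u, - p).
  - by split=> //=; apply: kos_degN.
  - rewrite kos_dS -ep raddfN subrr -[RHS]/(0, 0); congr pair.
    rewrite (raddfN (kos_d n V)) opprK; apply: FI.
    by rewrite raddf0 /F -kos_d_map ep kos_dd.
  rewrite kos_dS => -[eu' _]; exists (G u'); first exact: kos_deg_map.
  by rewrite kos_d_map -[RHS]eu -eu' [RHS]raddfD GF addr0.
rewrite kos_dS => -[eu ep].
have [||z dz ez] := HD (G u); first exact: kos_deg_map.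
  by rewrite kos_d_map -[kos_d n _ u](addrK (F p)) eu sub0r (raddfN G) GF oppr0.
have [u' du' eu'] := Gepi _ _ dz.
have [||q dq eq] := Fex i (u - kos_d n _ u').
- by apply: kos_degB => //; have := kos_deg_d du'; rewrite addrK.
- by rewrite raddfB -kos_d_map eu' ez subrr.
exists (u', q); first by split; rewrite /= ?addrK.
rewrite kos_dS eq addrC subrK; congr pair; apply: FI.
rewrite (raddfN F) /F -kos_d_map eq raddfB kos_dd subr0.
by apply/esym/eqP; rewrite -addr_eq0 addrC eu.
Qed.

(** * Injections of finite sets *)

Lemma FI_factor (R S T : finType) (f : FIinj R T) (g : FIinj S T) :
  (forall a, exists b, f a = g b) -> exists h : FIinj R S, f = FIcomp g h.
Proof.
case/fin_all_exists=> h fh; have hI : injective h.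
  by move=> a b e; apply: (@FIinj_inj _ _ f); rewrite !fh e.
by exists (mk_inj hI); apply: FIinjP => a; rewrite FIcompE mk_injE.
Qed.

Lemma FI_lift_option (R S : finType) (f : FIinj R (option S)) :
  (forall a, f a != None) -> exists h : FIinj R S, f = FIcomp (FIsome S) h.
Proof.
move=> fN; apply: FI_factor => a; have := fN a.
by case: (f a) => // s _; exists s; rewrite FIsomeE.
Qed.

Lemma FI_invertible (S T : finType) (f : FIinj S T) : (#|T| <= #|S|)%N ->
  exists g : FIinj T S, FIcomp g f = FIid S /\ FIcomp f g = FIid T.
Proof.
move=> le; have [g gf fg] := inj_card_bij (@FIinj_inj _ _ f) le.
exists (mk_inj (can_inj fg)).
by split; apply: FIinjP => a; rewrite !FIE mk_injE.
Qed.

Lemma FI_exists (S T : finType) : (#|S| <= #|T|)%N -> exists f : FIinj S T, True.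
Proof.
move=> le; have fI : injective (enum_val \o widen_ord le \o enum_rank : S -> T).
  move=> a b /enum_val_inj e; apply: enum_rank_inj; apply: val_inj.
  exact: (congr1 val e).
by exists (mk_inj fI).
Qed.

Lemma trivial_at_iso (W : FImod) (S T : finType) :
  #|S| = #|T| -> trivial_at W S -> trivial_at W T.
Proof.
move=> e WS x; have [f _] := @FI_exists S T (eq_leq e).
have [g [_ fg]] := FI_invertible f (eq_leq (esym e)).
by rewrite -[x]FImap_id -fg FImap_comp (WS (FImap W g x)) raddf0.
Qed.

(** The set of [n] points at which [kos n] evaluates modules. *)
Fixpoint opt (n : nat) : finType := if n is m.+1 then option (opt m) : finType else void.

Lemma card_opt n : #|opt n| = n.
Proof. by elim: n => [|n IH] /=; rewrite ?card_void // card_option IH. Qed.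

(** * Modules of bounded degree *)

Definition deg_lt (m : int) (W : FImod) := forall S : finType, m <= #|S|%:Z -> trivial_at W S.

Lemma deg_lt_Shift m (W : FImod) : deg_lt m W -> deg_lt (m - 1) (Shift W).
Proof. by move=> dW S le x; apply: (dW (option S)); rewrite card_option; lia. Qed.

(** A chain of degree [i] at [n] points lives on sets of [n - i] elements. *)
Lemma kos_deg_lt n m i (V : FImod) (x : kos n V) :
  deg_lt m V -> m + i <= n%:Z -> kos_deg i x -> x = 0.
Proof.
elim: n m i V x => [|n IH] m i V => [x|[u p]] dV le.
  by case=> // i0; apply: dV; rewrite card_void; lia.
case=> /= /(IH (m - 1)) -> //; last 2 first.
- exact: deg_lt_Shift.
- by lia.
by move=> /(IH m) -> //; lia.
Qed.

Lemma acyclic_deg_lt n m i (V : FImod) :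
  deg_lt m V -> m + i <= n%:Z -> acyclic n i V.
Proof.
move=> dV le x /(kos_deg_lt dV le) -> _.
by exists 0; [apply: kos_deg0|apply: raddf0].
Qed.

Lemma acyclic0 i (V : FImod) : 0 < i -> acyclic 0 i V.
Proof.
move=> i0 x dx _; exists 0; first exact: kos_deg0.
by rewrite raddf0; case: dx => // e; rewrite e in i0.
Qed.

(** * Acyclicity of free modules *)

Definition shift_split (V : FImod) :=
  exists r : FIhom (Shift V) V, forall (S : finType) x, r S (to_shift V S x) = x.

Definition swap_fun (S : finType) (x : option (option S)) : option (option S) :=
  match x with
  | Some (Some s) => Some (Some s)
  | Some None => None
  | None => Some None
  end.
Lemma swap_inj S : injective (@swap_fun S).
Proof. by case=> [[a|]|] [[b|]|]. Qed.
Definition swap (S : finType) := mk_inj (@swap_inj S).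

Lemma swap_nat (S T : finType) (f : FIinj S T) :
  FIcomp (swap T) (FIoption (FIoption f)) = FIcomp (FIoption (FIoption f)) (swap S).
Proof. by apply: FIinjP => -[[a|]|]; rewrite !FIE !mk_injE /= !FIE. Qed.

Lemma swap_some (S : finType) :
  FIcomp (swap S) (FIoption (FIsome S)) = FIsome (option S).
Proof. by apply: FIinjP => -[a|]; rewrite !FIE !mk_injE /= ?FIE. Qed.

Lemma some_swap (S : finType) :
  FIcomp (swap S) (FIsome (option S)) = FIoption (FIsome S).
Proof. by apply: FIinjP => -[a|]; rewrite !FIE !mk_injE /= ?FIE. Qed.

Lemma shift_split_Shift (V : FImod) : shift_split V -> shift_split (Shift V).
Proof.
case=> r rV.
pose r' S : {additive Shift (Shift V) S -> Shift V S} := r (option S) \o FImap V (swap S).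
have r'_nat (S T : finType) (f : FIinj S T) (x : Shift (Shift V) S) :
    r' T (FImap (Shift (Shift V)) f x) = FImap (Shift V) f (r' S x).
  by rewrite /= -FImap_comp swap_nat FImap_comp; apply: (FIhom_nat r (FIoption f)).
exists (FIHom r'_nat) => S x /=.
by rewrite -FImap_comp swap_some; apply: rV.
Qed.

Lemma kos_map_id n (V : FImod) (f : FIhom V V) x :
  (forall (S : finType) y, f S y = y) -> kos_map n f x = x.
Proof.
elim: n V f x => [|n IH] V f => [x|[u p]] fV; first by rewrite kos_map0 fV.
by rewrite kos_mapS !IH // => S y; apply: fV.
Qed.

(** A natural retraction of V -> Shift V splits the map whose cone is
    [kos n.+1 V], so that H_i of the cone is a quotient of H_i(Shift V), which
    vanishes by induction because [Shift V] is split too. *)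
Lemma acyclic_split n i (V : FImod) : shift_split V -> 0 < i -> acyclic n i V.
Proof.
move=> + i0; elim: n V => [|n IH] V sV; first exact: acyclic0.
case=> u p [/= du dp]; rewrite kos_dS => -[eu _].
(* In a cycle (u, p) the second component is determined by u: it is the
   boundary of minus the retraction of u. *)
have [r rV] := sV; pose q := kos_map n r u.
have rK x : kos_map n r (kos_map n (to_shift V) x) = x.
  by rewrite kos_map_comp; apply: kos_map_id.
have dq : kos_d n V q = - p.
  rewrite /q kos_d_map -[kos_d n _ u](addrK (kos_map n (to_shift V) p)) eu sub0r.
  by rewrite (raddfN (kos_map n r)) rK.
have degq : kos_deg i q by apply: kos_deg_map.
have [||u' du' eu'] := IH _ (shift_split_Shift sV) (u - kos_map n (to_shift V) q).
- by apply: kos_degB => //; apply: kos_deg_map.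
- by rewrite raddfB kos_d_map dq (raddfN (kos_map n _)) opprK.
exists (u', q); first by split; rewrite /= ?addrK.
by rewrite kos_dS eu' subrK dq opprK.
Qed.

(** The retraction of a free module forgets the generators whose injection hits
    the added point. *)
Section FreeCoverSplit.
Variable W : FImod.

Definition retract_gen (S : finType) (k : free_idx W (option S)) : free_cover W S :=
  if [pick g | FIcomp (FIsome S) g == (tagged k).2] is Some g
  then freeZ_gen (idx (tagged k).1 g) else 0.

Lemma FIsome_mono (R S : finType) (g h : FIinj R S) :
  FIcomp (FIsome S) g = FIcomp (FIsome S) h -> g = h.
Proof.
move=> e; apply: FIinjP => a.
by have := congr1 (fun f : FIinj _ _ => f a) e; rewrite !FIE => -[].
Qed.

Lemma retract_gen_some (S : finType) n (v : W 'I_n) (g : FIinj 'I_n S) :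
  retract_gen (idx v (FIcomp (FIsome S) g)) = freeZ_gen (idx v g).
Proof.
rewrite /retract_gen; case: pickP => [h /eqP/FIsome_mono -> //|/(_ g)].
by rewrite eqxx.
Qed.

Lemma retract_gen_none (S : finType) n (v : W 'I_n) (f : FIinj 'I_n (option S)) a :
  f a = None -> retract_gen (idx v f) = 0.
Proof.
move=> fa; rewrite /retract_gen; case: pickP => [h /eqP/= e|//].
by move: fa; rewrite -e !FIE.
Qed.

Definition retract_fun (S : finType) : {additive free_cover W (option S) -> free_cover W S} :=
  freeZ_lift (@retract_gen S).

Lemma free_push_idx (S T : finType) n (v : W 'I_n) (i : FIinj 'I_n S) (f : FIinj S T) :
  free_push f (idx v i) = idx v (FIcomp f i).
Proof. by []. Qed.

Lemma retract_fun_gen (S : finType) k : retract_fun S (freeZ_gen k) = retract_gen k.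
Proof. exact: freeZ_lift_gen. Qed.

Lemma retract_nat (S T : finType) (f : FIinj S T) (x : Shift (free_cover W) S) :
  retract_fun T (FImap (Shift (free_cover W)) f x) = FImap (free_cover W) f (retract_fun S x).
Proof.
apply: (freeZ_ext (f := retract_fun T \o FImap (Shift (free_cover W)) f)
  (g := FImap (free_cover W) f \o retract_fun S)) => -[n [v i]].
transitivity (retract_fun T (free_map W (FIoption f) (freeZ_gen (idx v i)))) => //.
transitivity (free_map W f (retract_fun S (freeZ_gen (idx v i)))) => //.
rewrite free_map_gen !retract_fun_gen free_push_idx.
have [/existsP[a /eqP ia]|] := boolP [exists a, i a == None].
  rewrite (retract_gen_none _ ia) raddf0 (@retract_gen_none _ _ _ _ a) //.
  by rewrite FIE ia FIE.
rewrite negb_exists => /forallP/FI_lift_option[h ->].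
rewrite retract_gen_some free_map_gen free_push_idx -retract_gen_some.
by congr (retract_gen (idx v _)); apply: FIinjP => a; rewrite !FIE.
Qed.

Lemma free_cover_split : shift_split (free_cover W).
Proof.
exists (FIHom retract_nat) => S x.
apply: (freeZ_ext (f := retract_fun S \o free_map W (FIsome S)) (g := idfun)) => -[n [v i]].
transitivity (retract_fun S (free_map W (FIsome S) (freeZ_gen (idx v i)))) => //.
by rewrite free_map_gen retract_fun_gen free_push_idx retract_gen_some.
Qed.

End FreeCoverSplit.

(** * The regularity bounds the degree of the kernel of the shift map *)

(** Group the points of a set of 2d + 1 elements as a point that is always left
    out and d pairs.  This is the sum, over the choices of one point in each pair,
    of the coefficients of a chain on the chosen points, all moved to one and the
    same set of d elements.  The two middle factors of
    K_(n+2) = (K_n Shift^2 + K_n Shift) + (K_n Shift + K_n) stand for the two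
    choices in a pair. *)
Fixpoint pair_sum_fun d (V : FImod) : kos d.*2.+1 V -> V (opt d) :=
  if d is e.+1 return kos d.*2.+1 V -> V (opt d)
  then fun x => @pair_sum_fun e (Shift V) (x.1.2 + x.2.1) else fun x => x.2.

Lemma pair_sum_subproof d V : zmod_morphism (@pair_sum_fun d V).
Proof.
elim: d V => [//|d IH] V x y /=.
apply: etrans (IH (Shift V) _ _); congr pair_sum_fun.
by rewrite opprD addrACA.
Qed.

HB.lock Definition pair_sum d (V : FImod) : {additive kos d.*2.+1 V -> V (opt d)} :=
  mk_additive (@pair_sum_subproof d V).

Lemma pair_sum0 (V : FImod) (u : kos 0 (Shift V)) (p : kos 0 V) : pair_sum 0 V (u, p) = p.
Proof. by rewrite pair_sum.unlock. Qed.

Lemma pair_sumS d (V : FImod) u p q r :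
  pair_sum d.+1 V ((u, p), (q, r)) = pair_sum d (Shift V) (p + q).
Proof. by rewrite !pair_sum.unlock. Qed.

(** The contributions of a chain that avoids both points of a pair cancel, since
    it enters the two middle components with opposite signs. *)
Lemma kos_d_mid n (V : FImod) u p q r (x := kos_d n.+2 V ((u, p), (q, r))) :
  x.1.2 + x.2.1 = - kos_d n (Shift V) (p + q).
Proof.
rewrite /x kos_dS /= kos_dS kos_mapS (kos_dS q) /=.
by rewrite (raddfD (kos_d _ _)) !opprD addrACA subrr addr0.
Qed.

Lemma pair_sum_d d V x : pair_sum d V (kos_d _ V x) = 0.
Proof.
elim: d V x => [|d IH] V; first by case=> u p; rewrite kos_dS pair_sum0 kos_d0 oppr0.
case=> [[u p] [q r]]; have := @kos_d_mid d.*2.+1 V u p q r.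
set y := kos_d _ _ _; case: y => [[u' p'] [q' r']] /= e.
by rewrite pair_sumS e (raddfN (pair_sum d _)) IH oppr0.
Qed.

Lemma pair_sum_epi d V z : exists2 x, kos_deg d.+1 x & pair_sum d V x = z.
Proof.
elim: d V z => [|d IH] V z.
  exists (0, z); last by rewrite pair_sum0.
  by split; [apply: kos_deg0|left].
have [x dx ex] := IH (Shift V) z.
exists ((0, x), (0, 0)); last by rewrite pair_sumS addr0.
have e : d.+2%:Z - 1 = d.+1 by lia.
by split; split; rewrite -/kos_deg ?e; try exact: kos_deg0.
Qed.

Lemma pair_sum_map d V W (f : FIhom V W) x :
  pair_sum d W (kos_map _ f x) = f _ (pair_sum d V x).
Proof.
elim: d V W f x => [|d IH] V W f; first by case=> u p; rewrite kos_mapS !pair_sum0 kos_map0.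
case=> [[u p] [q r]]; rewrite kos_mapS !kos_mapS !pair_sumS -(IH _ _ (Shift_hom f)).
by rewrite (raddfD (kos_map _ _)).
Qed.

(** The condition passes to [Shift V] because its shift map differs from the
    shift of that of [V] by a permutation of the two added points. *)
Lemma kos_d_eq0 n (V : FImod) x :
  (forall (S : finType) y, to_shift V S y = 0) -> kos_d n V x = 0.
Proof.
elim: n V x => [|n IH] V => [x|[u p]] V0; first exact: kos_d0.
rewrite kos_dS (IH V) // kos_map_eq0 // (IH (Shift V)) ?addr0 ?oppr0 // => S y.
by rewrite /= -some_swap FImap_comp (V0 (option S)) raddf0.
Qed.

Definition reg_lt (M : int) (V : FImod) :=
  forall i n : nat, (0 < i)%N -> M + i%:Z <= n%:Z -> acyclic n i V.

(** The kernel N of V -> Shift V has zero shift map, so all its chains are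
    cycles.  Those of degree d + 1 at 2d + 1 points become boundaries in the
    complex of V, hence are killed by [pair_sum], which takes every value in
    N([opt d]). *)
Lemma reg_lt_ker_shift (M : int) (V : FImod) :
  reg_lt M V -> deg_lt M (subFI (kerFI (to_shift V))).
Proof.
set N := subFI _ => HV S le; pose d := #|S|.
apply: (@trivial_at_iso N (opt d)); first exact: card_opt.
have N0 (T : finType) (y : N T) : to_shift N T y = 0.
  by apply: val_inj; have /mem_kerFI := valP y.
move=> z; have [x dx <-] := @pair_sum_epi d N z.
have le' : M + d.+1%:Z <= d.*2.+1%:Z by rewrite /d; lia.
have [||y dy ey] := HV _ _ (ltn0Sn d) le' (kos_map _ (sub_incl _) x).
- exact: kos_deg_map.
- by rewrite kos_d_map kos_d_eq0 // raddf0.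
apply: val_inj; rewrite -[LHS](pair_sum_map (sub_incl (kerFI (to_shift V))) x) -ey.
exact: pair_sum_d.
Qed.

(** * Homology in degree 0 *)

(** The chains of degree 0 are those supported on the whole set. *)
Fixpoint kos_top_fun n (V : FImod) : V (opt n) -> kos n V :=
  if n is m.+1 return V (opt n) -> kos n V
  then fun x => (@kos_top_fun m (Shift V) x, 0) else id.

Lemma kos_top_subproof n V : zmod_morphism (@kos_top_fun n V).
Proof.
elim: n V => [//|n IH] V x y /=.
by congr pair; [exact: (IH (Shift V))|rewrite /= subr0].
Qed.

HB.lock Definition kos_top n (V : FImod) : {additive V (opt n) -> kos n V} :=
  mk_additive (@kos_top_subproof n V).

Lemma kos_top0 (V : FImod) x : kos_top 0 V x = x.
Proof. by rewrite kos_top.unlock. Qed.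

Lemma kos_topS n (V : FImod) x : kos_top n.+1 V x = (kos_top n (Shift V) x, 0).
Proof. by rewrite !kos_top.unlock. Qed.

Lemma kos_deg_top n V x : kos_deg 0 (kos_top n V x).
Proof.
elim: n V x => [|n IH] V x; first by left.
by rewrite kos_topS; split; [apply: IH|apply: kos_deg0].
Qed.

Lemma kos_top_epi n V y : kos_deg 0 y -> exists x, kos_top n V x = y.
Proof.
elim: n V y => [|n IH] V => [y _|[u p] [/= du dp]]; first by exists y; rewrite kos_top0.
have [x <-] := IH _ _ du; exists x.
by rewrite kos_topS (kos_deg_lt0 _ dp).
Qed.

Lemma kos_map_top n V W (f : FIhom V W) x :
  kos_map n f (kos_top n V x) = kos_top n W (f _ x).
Proof.
elim: n V W f x => [|n IH] V W f x; first by rewrite !kos_top0 kos_map0.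
by rewrite !kos_topS kos_mapS raddf0 -(IH _ _ (Shift_hom f)).
Qed.

Lemma proper_sub_nonsurj (V : FImod) (R S : finType) (g : FIinj R S) s y :
  (forall a, g a != s) -> FImap V g y \in proper_sub V S.
Proof.
move=> gs; have [a|h ->] := @FI_factor _ _ _ g (FIincl [set~ s]%SET).
  have ga : g a \in [set~ s]%SET by rewrite finset.in_setC1 gs.
  by exists (exist _ (g a) ga); rewrite FIinclE.
rewrite FImap_comp; apply/mem_mk_FIsub/from_proper1.
apply/fintype.properP; split; first exact: finset.subsetT.
by exists s; rewrite ?finset.in_setT // finset.in_setC1 eqxx.
Qed.

Lemma proper_sub_ind (V : FImod) (S : finType) (Q : V S -> Prop) :
  Q 0 -> (forall x y, Q x -> Q y -> Q (x + y)) ->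
  (forall (A : {set S}) s y, s \notin A -> Q (FImap V (FIincl A) y)) ->
  forall x, x \in proper_sub V S -> Q x.
Proof.
move=> Q0 QD QA x /mem_mk_FIsub[y ->]; apply: big_rec => // A z pA Qz.
apply: QD => //; have /fintype.properP[_ [s _ sA]] := pA; exact: QA sA.
Qed.

(** A proper subset of [option S] either omits [None], and then its contribution
    comes from V(S), or has the form [option A] with [A] a proper subset of [S].
    This is the recursion that the boundaries of degree 0 satisfy. *)
Lemma proper_sub_option (V : FImod) (S : finType) x :
  x \in proper_sub V (option S) <->
  exists p, (x : Shift V S) - to_shift V S p \in proper_sub (Shift V) S.
Proof.
split=> [|[p xp]].
  move: x; apply: proper_sub_ind.
  - by exists 0; rewrite raddf0 subr0 rpred0.
  - by move=> x y [p xp] [q yq]; exists (p + q); rewrite raddfD opprD addrACA rpredD.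
  move=> A s y sA; have [NA|NA] := boolP (None \in A); last first.
    have [a|h eh] := @FI_lift_option _ _ (FIincl A).
      by rewrite FIinclE; apply: contraNneq NA => <-; apply: valP.
    by exists (FImap V h y); rewrite eh FImap_comp subrr rpred0.
  case: s sA => [s|]; last by rewrite NA.
  move=> sA; exists 0; rewrite raddf0 subr0.
  pose B := [set t | Some t \in A]%SET.
  have [[[t|] tA]|h ->] := @FI_factor _ _ _ (FIincl A) (FIoption (FIincl B)).
  - have tB : t \in B by rewrite finset.inE.
    by exists (Some (exist _ t tB)); rewrite !FIE /= FIinclE.
  - by exists None; rewrite !FIE.
  rewrite FImap_comp; apply: (@proper_sub_nonsurj (Shift V) _ _ (FIincl B) s).
  by move=> [t tB]; rewrite FIinclE /=; apply: contraNneq sA => <-; rewrite finset.inE in tB.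
rewrite -[x](subrK (to_shift V S p)); apply: rpredD; last first.
  by apply: (@proper_sub_nonsurj _ _ _ _ None) => a; rewrite FIsomeE.
move: xp; apply: (@proper_sub_ind (Shift V) S (fun z => z \in proper_sub V (option S))).
- exact: rpred0.
- by move=> ? ?; apply: rpredD.
move=> A s y sA; apply: (@proper_sub_nonsurj _ _ _ _ (Some s)) => -[a|]; rewrite !FIE //=.
by rewrite FIinclE; apply: contraNneq sA => -[<-]; apply: (valP a).
Qed.

Lemma kos_top_boundary n (V : FImod) x :
  (exists2 y, kos_deg 1 y & kos_d n V y = kos_top n V x) <->
  x \in proper_sub V (opt n).
Proof.
elim: n V x => [|n IH] V x.
  split=> [[y _]|]; first by rewrite kos_d0 kos_top0 => <-; apply: rpred0.
  move=> h; exists 0; first exact: kos_deg0.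
  move: x h; apply: proper_sub_ind => [|x y ex ey|? []]; rewrite ?raddf0 //.
  by rewrite raddfD -ex -ey !kos_d0 addr0.
rewrite [X in _ <-> X]proper_sub_option; split.
  case=> -[u p] [/= du dp]; rewrite kos_dS kos_topS => -[eu _].
  have [q eq] := kos_top_epi dp.
  exists q; apply/(IH (Shift V)); exists u => //.
  by rewrite (raddfB (kos_top _ _)) -(kos_map_top (to_shift V)) eq -eu addrK.
case=> q /(IH (Shift V))[u du eu].
exists (u, kos_top n V q); first by split=> //=; rewrite subrr; apply: kos_deg_top.
rewrite kos_dS kos_topS eu (raddfB (kos_top _ _)) -(kos_map_top (to_shift V)) subrK; congr pair.
by rewrite (kos_deg_lt0 _ (kos_deg_d (kos_deg_top _))) ?oppr0.
Qed.

(** * Comparison with FI-homology *)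

Lemma FIhom_proper_sub (A B : FImod) (f : FIhom A B) (S : finType) x :
  x \in proper_sub A S -> f S x \in proper_sub B S.
Proof. by move=> /HFI0_map_subproof-/(_ B f)/quot_pi_eq0. Qed.

Lemma proper_sub_epi (A B : FImod) (f : FIhom A B) (S : finType) y : FIepi f ->
  y \in proper_sub B S -> exists2 x, x \in proper_sub A S & f S x = y.
Proof.
move=> fE; move: y; apply: proper_sub_ind.
- by exists 0; rewrite ?rpred0 ?raddf0.
- move=> y z [x px <-] [x' px' <-]; exists (x + x'); first exact: rpredD.
  exact: raddfD.
move=> D s y sD; have [x <-] := fE _ y.
exists (FImap A (FIincl D) x); last by rewrite FIhom_nat.
apply: (@proper_sub_nonsurj _ _ _ _ s) => a; rewrite FIinclE.
by apply: contraNneq sD => <-; apply: valP.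
Qed.

(** When [d] presents [A] as a cokernel, right exactness makes [HFI0 A] the
    cokernel of [HFI0 d], so the homology below is the kernel of
    HFI0 A -> HFI0 Q. *)
Lemma homology_trivial (P' P A Q : FImod) (d : FIhom P' P) (a : FIhom P A)
    (j : FIhom A Q) (S : finType) : FIepi a -> exact_at d a ->
  trivial_at (homology (HFI0_map d) (HFI0_map (FIhom_comp j a))) S <->
  forall y, j S y \in proper_sub Q S -> y \in proper_sub A S.
Proof.
move=> aE da; set D := HFI0_map d; set E := HFI0_map _.
split=> [triv y jy|inj w].
  have [x ax] := aE S y.
  have Ez : quot_pi (proper_sub P) S x \in kerFI E S.
    by apply/mem_kerFI; rewrite [LHS]HFI0_map_pi; apply/quot_pi_eq0; rewrite /= ax.
  pose z : subFI (kerFI E) S := exist (fun z => z \in kerFI E S) _ Ez.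
  have /quot_pi_eq0/mem_mk_FIsub[x' /= ex'] := triv (quot_pi (boundaries D E) S z).
  move: ex'; rewrite -[x']quot_pi_repr [LHS]HFI0_map_pi => e.
  have /quot_pi_eq/(FIhom_proper_sub a) : quot_pi (proper_sub P) S x = _ := esym e.
  rewrite raddfB ax.
  by have -> : a S (d S (repr x')) = 0; [apply/da; exists (repr x')|rewrite subr0].
rewrite -[w]quot_pi_repr; apply/quot_pi_eq0; move: (repr _) => {w} [z Ez].
apply/mem_mk_FIsub => /=.
have /mem_kerFI := Ez; pose x : P S := repr (z : Quotient.quot (proper_sub P S)).
have ez : z = quot_pi (proper_sub P) S x by rewrite quot_pi_repr.
rewrite [in E S z]ez [X in X = _ -> _]HFI0_map_pi => /quot_pi_eq0/inj/(proper_sub_epi aE)[x0 px0 ax0].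
have /da[x' dx'] : a S (x - x0) = 0 by rewrite raddfB ax0 subrr.
exists (quot_pi (proper_sub P') S x'); rewrite [LHS]HFI0_map_pi dx'.
apply: etrans (esym ez); apply/quot_pi_eq; by rewrite addrAC subrr sub0r rpredN.
Qed.

Section Syzygies.
Variable V : FImod.

(** The standard resolution is spliced from the short exact sequences
    0 -> syz (j+1) -> P_j -> syz j -> 0. *)
Definition syz (j : nat) : FImod :=
  if j is k.+1 then subFI (kerFI (stage_hom (std_stage V k))) else V.

Definition syz_aug (j : nat) : FIhom (stage_dom (std_stage V j)) (syz j) :=
  match j with 0 => free_aug V | k.+1 => free_aug _ end.

Lemma syz_aug_eq0 j (S : finType) y :
  syz_aug j S y = 0 <-> stage_hom (std_stage V j) S y = 0.
Proof.
case: j y => [//|j] y; split=> [y0|y0]; last exact: val_inj.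
by rewrite /= [X in sub_incl_fun X]y0.
Qed.

Lemma syz_exact j :
  short_exact (sub_incl (kerFI (stage_hom (std_stage V j)))) (syz_aug j).
Proof.
split.
- by move=> S x y /val_inj.
- move=> S y; rewrite syz_aug_eq0.
  split=> [y0|[x <-]]; last by apply/mem_kerFI/(valP x).
  by have ky : y \in kerFI (stage_hom (std_stage V j)) S; [apply/mem_kerFI|exists (exist _ y ky)].
- by case: j => [|j]; apply: free_aug_epi.
Qed.

Lemma acyclic_res n i j : 0 < i -> acyclic n i (stage_dom (std_stage V j)).
Proof. by apply: acyclic_split; case: j => [|j]; apply: free_cover_split. Qed.

Lemma acyclic_syz n i j : acyclic n i.+1 (syz j) <-> acyclic n 1 (syz (j + i)).
Proof.
elim: i j => [|i IH] j; first by rewrite addn0.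
rewrite -addSnnS -IH; have e : i.+2%:Z = i.+1%:Z + 1 by lia.
have res0 := @acyclic_res n i.+1 j isT; have res1 := @acyclic_res n i.+2 j isT.
split=> [|H]; first by rewrite e; apply: (acyclic_left (syz_exact j) res0).
by apply: (acyclic_right (syz_exact j) res1); rewrite e addrK.
Qed.

Lemma acyclic1_syz n j : acyclic n 1 (syz j) <->
  forall y : syz j.+1 (opt n), sub_incl (kerFI (stage_hom (std_stage V j))) _ y
    \in proper_sub (stage_dom (std_stage V j)) (opt n) -> y \in proper_sub (syz j.+1) (opt n).
Proof.
rewrite (acyclic1_quot (syz_exact j) (@acyclic_res n 1 j isT)); split=> H y.
  move=> /kos_top_boundary[z dz ez]; apply/kos_top_boundary; apply: H.
    exact: kos_deg_top.
  by exists z => //; rewrite ez -kos_map_top.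
move=> /kos_top_epi[x <-]; rewrite kos_map_top => /kos_top_boundary /H.
by move=> /kos_top_boundary.
Qed.

Lemma HFI_acyclic i n : trivial_at (HFI i.+1 V) (opt n) <-> acyclic n i.+1 V.
Proof.
rewrite (acyclic_syz n i 0) acyclic1_syz add0n.
apply: (homology_trivial (a := free_aug (syz i.+1))
  (d := stage_hom (std_stage V i.+2))); first exact: free_aug_epi.
move=> S y; apply: (iff_trans (syz_aug_eq0 (j := i.+1) y)).
exact: (@next_stage_exact (std_stage V i.+1)).
Qed.

End Syzygies.

(** * The derivative *)

Lemma Delta_trivial (W : FImod) (S : finType) :
  trivial_at W (option S) -> trivial_at (Delta W) S.
Proof.
move=> W0 x; rewrite -[x]quot_pi_repr; set y := repr _.
by rewrite (W0 y : y = 0) raddf0.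
Qed.

Lemma deg_lt_Delta m (W : FImod) : deg_lt m W -> deg_lt (m - 1) (Delta W).
Proof. by move=> dW S le; apply/Delta_trivial/(deg_lt_Shift dW). Qed.

Section DeltaHom.
Variables (V W : FImod) (f : FIhom V W).

Lemma Delta_hom_subproof (S : finType) x : x \in imFI (to_shift V) S ->
  (quot_pi (imFI (to_shift W)) S \o Shift_hom f S) x = 0.
Proof.
move=> /mem_imFI[y <-]; apply/quot_pi_eq0/mem_imFI; exists (f S y).
exact: (esym (FIhom_nat f (FIsome S) y)).
Qed.

Definition Delta_hom_at (S : finType) : {additive Delta V S -> Delta W S} :=
  quot_lift (@Delta_hom_subproof S).

Lemma Delta_hom_pi (S : finType) (x : Shift V S) :
  Delta_hom_at S (quot_pi (imFI (to_shift V)) S x) =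
  quot_pi (imFI (to_shift W)) S (Shift_hom f S x).
Proof. exact: quot_lift_pi. Qed.

Lemma Delta_hom_nat (S T : finType) (h : FIinj S T) x :
  Delta_hom_at T (FImap (Delta V) h x) = FImap (Delta W) h (Delta_hom_at S x).
Proof.
rewrite -[x]quot_pi_repr quotFI_map_pi !Delta_hom_pi quotFI_map_pi.
by congr (quot_pi _ _ _); apply: FIhom_nat.
Qed.

Definition Delta_hom : FIhom (Delta V) (Delta W) := FIHom Delta_hom_nat.

End DeltaHom.

(** Part of the snake lemma: injectivity of C -> Shift C makes the connecting map
    from its kernel to [Delta A] disappear. *)
Lemma Delta_exact (A B C : FImod) (f : FIhom A B) (g : FIhom B C) :
  short_exact f g -> (forall S : finType, injective (to_shift C S)) ->
  short_exact (Delta_hom f) (Delta_hom g).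
Proof.
move=> ex Ci; have gE := short_exact_epi ex; have fI := short_exact_inj ex.
split=> S.
- apply/raddf_inj => x; rewrite -[x]quot_pi_repr; move: (repr _) => {}x.
  rewrite [LHS]Delta_hom_pi => /quot_pi_eq0/mem_imFI[b eb].
  have gb : g S b = 0.
    apply: Ci; rewrite raddf0 -FIhom_nat eb.
    by apply/(short_exact_mid ex); exists x.
  have [a ea] := (short_exact_mid ex b).1 gb.
  apply/quot_pi_eq0/mem_imFI; exists a; apply: fI.
  by rewrite -[RHS]eb -ea -FIhom_nat.
- move=> y; rewrite -[y]quot_pi_repr; move: (repr _) => {}y.
  split=> [|[x <-]].
    rewrite [LHS]Delta_hom_pi => /quot_pi_eq0/mem_imFI[c ec].
    have [b eb] := gE S c.
    have [|a ea] := (short_exact_mid ex ((y : Shift B S) - to_shift B S b)).1.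
      by rewrite raddfB -[g _ y]ec -eb FIhom_nat subrr.
    exists (quot_pi (imFI (to_shift A)) S a); rewrite [LHS]Delta_hom_pi.
    rewrite [Shift_hom f S a]ea; apply/quot_pi_eq/mem_imFI; exists (- b).
    by rewrite raddfN addrAC subrr sub0r.
  rewrite -[x]quot_pi_repr; move: (repr _) => {}x.
  have -> : Delta_hom f S (quot_pi _ S x) = quot_pi _ S (Shift_hom f S x) := Delta_hom_pi f x.
  rewrite [LHS]Delta_hom_pi; apply/quot_pi_eq0.
  suff -> : Shift_hom g S (Shift_hom f S x) = 0 by apply: rpred0.
  by apply/(short_exact_mid ex); exists x.
- move=> z; rewrite -[z]quot_pi_repr; move: (repr _) => {}z.
  have [y <-] := gE _ z; exists (quot_pi (imFI (to_shift B)) S y); exact: Delta_hom_pi.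
Qed.

(** * Torsion *)

(** An injection is a composite of maps S -> S + point and a bijection, and the
    intermediate sets are at least as large as [S]. *)
Lemma FImap_eq0 m (V : FImod) (S T : finType) (f : FIinj S T) x :
  deg_lt m (subFI (kerFI (to_shift V))) -> m <= #|S|%:Z -> FImap V f x = 0 -> x = 0.
Proof.
move=> dK; have [k] := ubnP (#|T| - #|S|); elim: k S f x => // k IH S f x.
rewrite ltnS => lek le fx.
have [leTS|ltST] := leqP #|T| #|S|.
  have [g [gf _]] := FI_invertible f leTS.
  by rewrite -[x]FImap_id -gf FImap_comp fx raddf0.
have [t tf] : exists t, forall a, f a != t.
  apply/not_existsP => tf; move: ltST; rewrite ltnNge => /negP; apply.
  have sf t : exists a, t == f a.
    by have /existsNP[a /negP] := tf t; rewrite negbK => /eqP <-; exists a.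
  have [h fh] := fin_all_exists sf.
  by apply: (@leq_card _ _ h) => a b e; rewrite (eqP (fh a)) (eqP (fh b)) e.
have hI : injective (fun o : option S => if o is Some s then f s else t).
  move=> [a|] [b|] // => [/FIinj_inj -> //|e|e].
  - by have := tf a; rewrite e eqxx.
  - by have := tf b; rewrite e eqxx.
have fE : f = FIcomp (mk_inj hI) (FIsome S).
  by apply: FIinjP => a; rewrite !FIE mk_injE.
have kx : x \in kerFI (to_shift V) S.
  apply/mem_kerFI; apply: (IH (option S) (mk_inj hI)).
  - by rewrite card_option; lia.
  - by rewrite card_option; lia.
  - by rewrite -FImap_comp -fE.
exact: (congr1 val (dK S le (exist _ x kx))).
Qed.

Lemma deg_lt_H0m m (V : FImod) :
  deg_lt m (subFI (kerFI (to_shift V))) -> deg_lt m (H0m V).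
Proof.
move=> dK S le x; have [T [f /(congr1 val) fx]] := torsion_part_torsion x.
by apply: val_inj; apply: FImap_eq0 dK le fx.
Qed.

Lemma deg_lt_torsion m (V : FImod) :
  deg_lt m (subFI (kerFI (to_shift V))) -> torsion V -> deg_lt m V.
Proof. by move=> dK tV S le x; have [T [f fx]] := tV S x; apply: FImap_eq0 dK le fx. Qed.

Lemma torsion_deg_lt m (V : FImod) : deg_lt m V -> torsion V.
Proof.
move=> dV S x; have [f _] : exists f : FIinj S 'I_(#|S| + absz m), True.
  by apply: FI_exists; rewrite card_ord leq_addr.
by exists _, f; apply: dV; rewrite card_ord; lia.
Qed.

Definition torsion_free_quot (V : FImod) := quotFI (torsion_part V).

Lemma torsion_exact (V : FImod) :
  short_exact (sub_incl (torsion_part V)) (quot_proj (torsion_part V)).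
Proof.
split.
- by move=> S x y /val_inj.
- move=> S y; rewrite [X in X <-> _]quot_pi_eq0; split=> [ty|[x <-]]; last exact: valP x.
  by exists (exist _ y ty).
- by move=> S y; exists (repr y); apply: quot_pi_repr.
Qed.

(** An element that becomes torsion after one step is torsion, so the kernel of
    V -> Shift (V/T) is a torsion submodule. *)
Lemma torsion_free_quot_inj (V : FImod) (S : finType) :
  injective (to_shift (torsion_free_quot V) S).
Proof.
apply/raddf_inj => x.
pose p := FIhom_comp (to_shift (torsion_free_quot V)) (quot_proj (torsion_part V)).
rewrite -[x]quot_pi_repr; move: (repr _) => {}x px.
apply/quot_pi_eq0/(@torsion_part_largest V (kerFI p)); last exact/mem_kerFI.
apply/torsion_subP => {px x}S x /mem_kerFI.
rewrite [LHS]quotFI_map_pi => /quot_pi_eq0/mem_mk_FIsub[N /torsion_subP tN Nx].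
have [T [f fx]] := tN _ _ Nx.
by exists T, (FIcomp f (FIsome S)); rewrite FImap_comp.
Qed.

(** An element of V(option S) killed by [f] is also killed by [option g], for [g]
    the restriction of [f] to [S]: up to an injection of [option T] the latter
    factors through [f]. *)
Lemma torsion_Delta (W : FImod) : torsion W -> torsion (Delta W).
Proof.
move=> tW S x; rewrite -[x]quot_pi_repr; move: (repr _) => {}x.
have [T [f fx]] := tW (option S) x.
pose c := f None.
(* h swaps None and Some c. *)
pose h (o : option T) := if o is Some t then if t == c then None else Some t else Some c.
have hI : injective h.
  case=> [a|] [b|] //=; do ?case: eqP => // ?; try by move=> [] *; congruence.
  by move=> _; congruence.
have [g gE] : exists g : FIinj S T, forall s, g s = f (Some s).
  by exists (FIcomp f (FIsome S)) => s; rewrite !FIE.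
have e : FIoption g = FIcomp (mk_inj hI) (FIcomp (FIsome T) f).
  apply: FIinjP => -[s|]; rewrite !FIE mk_injE /= ?gE ?eqxx //.
  by case: eqP => [/FIinj_inj|].
exists T, g; rewrite [LHS]quotFI_map_pi.
have -> : FImap (Shift W) g x = 0; last exact: raddf0.
by rewrite /= e !FImap_comp fx !raddf0.
Qed.

(** * Regularity of a module and of its derivative *)

(** For M = 0 all higher homology vanishes: reg V <= -1 implies reg V = -2.  The
    induction must carry this stronger property, since the step from [Delta V] to
    [V] raises the bound by one whereas max(0, M - 1) does not decrease at 0. *)
Definition reg_lt_strong (M : int) (V : FImod) :=
  forall i n : nat, (0 < i)%N -> M = 0 \/ M + i%:Z <= n%:Z -> acyclic n i V.

Lemma acyclic_deg_lt_strong (M : int) (V : FImod) (i n : nat) :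
  deg_lt M V -> M <= 0 \/ M + i%:Z <= n%:Z -> acyclic n i V.
Proof.
move=> dV [M0|le]; last exact: acyclic_deg_lt dV le.
have dV' : deg_lt (- i%:Z) V by move=> S _; apply: dV; lia.
by apply: (acyclic_deg_lt dV'); lia.
Qed.

Lemma reg_lt_torsion (M : int) (V : FImod) : reg_lt M V -> deg_lt M (H0m V).
Proof. by move=> rV; apply/deg_lt_H0m/reg_lt_ker_shift. Qed.

(** H_i(V) lies between H_i(T) and H_i(V/T), and H_i(V/T) is computed by
    Delta (V/T), whose homology lies between H_i(Delta V) and
    H_(i-1)(Delta T). *)
Lemma reg_lt_strong_step (M : int) (V : FImod) : 0 <= M -> deg_lt M (H0m V) ->
  reg_lt_strong (Num.max 0 (M - 1)) (Delta V) -> reg_lt_strong M V.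
Proof.
move=> M0 dT rD i [|n] i0 le; first exact: acyclic0.
have tf := @torsion_free_quot_inj V.
apply: (acyclic_mid (torsion_exact V)); first by apply: (acyclic_deg_lt_strong dT); lia.
apply/(acyclic_Delta _ _ tf).
apply: (acyclic_right (Delta_exact (torsion_exact V) tf)); first by apply: rD => //; lia.
have -> : i%:Z - 1 = i.-1 by lia.
by apply: (acyclic_deg_lt_strong (deg_lt_Delta dT)); lia.
Qed.

(** H_i(Delta V) lies between H_i(Delta T) and H_i(Delta (V/T)); the latter is
    H_i(V/T) at one point more, which lies between H_i(V) and H_(i-1)(T). *)
Lemma reg_lt_Delta (M : int) (V : FImod) : 0 <= M -> reg_lt M V ->
  reg_lt (Num.max 0 (M - 1)) (Delta V).
Proof.
move=> M0 rV i n i0 le; have dT := reg_lt_torsion rV.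
have tf := @torsion_free_quot_inj V.
apply: (acyclic_mid (Delta_exact (torsion_exact V) tf)).
  by apply: (acyclic_deg_lt_strong (deg_lt_Delta dT)); lia.
apply/(acyclic_Delta _ _ tf).
apply: (acyclic_right (torsion_exact V)); first by apply: rV => //; lia.
have -> : i%:Z - 1 = i.-1 by lia.
by apply: (acyclic_deg_lt_strong dT); lia.
Qed.

(** * Degrees as extended integers *)

Lemma emin_le (P : int -> Prop) (d : int) : -1 <= d ->
  (forall k : int, -1 <= k -> P k -> P (k + 1)) ->
  (emin [set (k%:E)%E | k in [set k : int | (-1 <= k)%R /\ P k]]%classic <= d%:E)%E <-> P d.
Proof.
move=> d1 PS; set A := [set _ | _ in _]%classic.
have up (k : int) (m : nat) : -1 <= k -> P k -> P (k + m%:Z).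
  move=> k1 Pk; elim: m => [|m IH]; first by rewrite addr0.
  by have -> : k + m.+1 = (k + m) + 1; [lia|apply: PS; [lia|]].
rewrite /emin; split=> [|Pd].
  case: xgetP => [x -> [[k [k1 Pk] <-] _]|_]; last by rewrite leye_eq.
  rewrite lee_fin => le; have -> : d = k + (absz (d - k))%:Z by lia.
  exact: up.
(* Integers k >= -1 are searched as the naturals k + 1. *)
have exA : exists m : nat, `[< P (m%:Z - 1) >].
  by exists (absz (d + 1)); apply/asboolP; have -> : (absz (d + 1))%:Z - 1 = d by lia.
have [m /asboolP Pm minm] := ex_minnP exA.
have mA : [set x | A x /\ lbound A x]%classic (m%:Z - 1)%:E%E.
  split; first by exists (m%:Z - 1) => //; split; first lia.
  move=> _ [k [k1 Pk] <-]; rewrite lee_fin.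
  have := minm (absz (k + 1)); have -> : (absz (k + 1))%:Z - 1 = k by lia.
  by move/(_ (asboolT Pk)); lia.
have [_ lb] := xgetPex +oo%E (ex_intro _ _ mA); apply: lb.
by exists d.
Qed.

Lemma deg_le (W : FImod) (d : int) : -1 <= d -> (deg W <= d%:E)%E <-> deg_lt (d + 1) W.
Proof.
move=> d1; rewrite /deg emin_le //; last by move=> k _ Pk S le; apply: Pk; lia.
by split=> H S le; apply: H; lia.
Qed.

Lemma deg_fin (W : FImod) (d : int) : (deg W <= d%:E)%E ->
  exists2 k : int, -1 <= k & deg W = (k%:E)%E.
Proof.
rewrite /deg /emin; case: xgetP => [x -> [[k [k1 _] <-] _] _|_]; last by rewrite leye_eq.
by exists k.
Qed.

Lemma delta_le (V : FImod) (r : int) : -1 <= r ->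
  (delta V <= r%:E)%E <-> torsion (iter (absz (r + 1)) Delta V).
Proof.
move=> r1; rewrite /delta (emin_le (P := fun r => torsion (iter (absz (r + 1)) Delta V))) //.
move=> k k1; have -> : absz (k + 1 + 1) = (absz (k + 1)).+1 by lia.
exact: torsion_Delta.
Qed.

(** The maximum exists once the values are bounded: they are integers because
    each [t_ i V], bounded above, is the degree of a module and hence at
    least -1. *)
Lemma reg_le (V : FImod) (N : int) :
  (reg V <= N%:E)%E <-> forall i, (0 < i)%N -> (t_ i V <= (N + i%:Z)%:E)%E.
Proof.
rewrite /reg /emax; set A := [set _ | _ in _]%classic.
have AE i : (0 < i)%N -> A (t_ i V - i%:Z%:E)%E by move=> i0; exists i.
have leE i : (t_ i V - i%:Z%:E <= N%:E)%E = (t_ i V <= (N + i%:Z)%:E)%E.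
  by rewrite leeBlDr // EFinD.
split=> [+ i i0|tN].
  case: xgetP => [x -> [_ ub] xN|_]; last by rewrite leye_eq.
  by rewrite -leE; apply: le_trans xN; apply/ub/AE.
(* m is the defect of a value from the bound N; the least one gives the maximum. *)
have exA : exists m : nat, `[< exists2 i, (0 < i)%N & t_ i V = (N + i%:Z - m%:Z)%:E%E >].
  have [k k1 ek] := deg_fin (tN 1 isT); exists (absz (N + 1 - k)%R).
  apply/asboolP; exists 1%N => //; rewrite /t_ ek; congr EFin.
  by have := tN 1 isT; rewrite /t_ ek lee_fin; lia.
have [m /asboolP[i i0 ei] minm] := ex_minnP exA.
have mA : [set x | A x /\ ubound A x]%classic (N - m%:Z)%:E%E.
  split; first by exists i => //; rewrite ei -EFinB; congr EFin; lia.
  move=> _ [j j0 <-]; have [k k1 ek] := deg_fin (tN j j0).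
  have := tN j j0; rewrite /t_ ek -EFinB !lee_fin => le.
  have /minm : `[< exists2 i, (0 < i)%N & t_ i V = (N + i%:Z - (absz (N + j%:Z - k)%R)%:Z)%:E%E >].
    by apply/asboolP; exists j => //; rewrite /t_ ek; congr EFin; lia.
  by lia.
have [[j j0 <-] _] := xgetPex +oo%E (ex_intro _ _ mA).
by rewrite leE; apply: tN.
Qed.

Lemma deg_lt_HFI (M : int) i (V : FImod) :
  deg_lt M (HFI i.+1 V) <-> forall n : nat, M <= n%:Z -> acyclic n i.+1 V.
Proof.
split=> [dH n le|aV S le]; first by apply/HFI_acyclic/dH; rewrite card_opt.
by apply: (trivial_at_iso (card_opt #|S|)); apply/HFI_acyclic/aV.
Qed.

Lemma reg_lt_le (V : FImod) (M : int) : 0 <= M ->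
  (reg V <= (M - 1)%:E)%E <-> reg_lt M V.
Proof.
move=> M0; rewrite reg_le; split=> [tV [//|i] n _ le|rV [//|i] _].
  have d1 : -1 <= M - 1 + i.+1%:Z by lia.
  have dH := (deg_le _ d1).1 (tV i.+1 isT).
  by apply: ((deg_lt_HFI _ _ _).1 dH); lia.
have d1 : -1 <= M - 1 + i.+1%:Z by lia.
by apply/(deg_le _ d1)/deg_lt_HFI => n le; apply: rV => //; lia.
Qed.

(** * The recursive classes *)

Lemma Poly2_rec_reg k (M : int) (V : FImod) : 0 <= M ->
  Poly2_rec k M V -> torsion (iter k Delta V) /\ reg_lt_strong M V.
Proof.
elim: k M V => [|k IH] M V M0 /=.
  have d1 : -1 <= M - 1 by lia.
  move=> /(deg_le _ d1); rewrite subrK => dV.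
  split; first exact: torsion_deg_lt dV.
  by move=> i n i0 le; apply: (acyclic_deg_lt_strong dV); lia.
have d1 : -1 <= M - 1 by lia.
case=> /(deg_le _ d1); rewrite subrK => dT /IH[|tD rD]; first by lia.
by rewrite -iterS iterSr; split=> //; apply: reg_lt_strong_step.
Qed.

Lemma reg_Poly2_rec k (M : int) (V : FImod) : 0 <= M ->
  torsion (iter k Delta V) -> reg_lt M V -> Poly2_rec k M V.
Proof.
elim: k M V => [|k IH] M V M0 tV rV /=; have d1 : -1 <= M - 1 by lia.
  apply/(deg_le _ d1); rewrite subrK.
  by apply: deg_lt_torsion tV; apply: reg_lt_ker_shift.
split; first by apply/(deg_le _ d1); rewrite subrK; apply: reg_lt_torsion.
by apply: IH; [lia|rewrite -iterSr|apply: reg_lt_Delta].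
Qed.

Theorem theoremB (r M : int) (hr : -1 <= r) (hM : 0 <= M) (V : FImod) :
  Poly2 r M V <-> ((delta V <= r%:E)%E /\ (reg V <= (M - 1)%:E)%E).
Proof.
rewrite delta_le // reg_lt_le //; split=> [/(Poly2_rec_reg hM)[tV rV]|[tV rV]].
  by split=> // i n i0 le; apply: rV => //; right.
exact: reg_Poly2_rec.
Qed.
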